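(* Let $\{x^k\}_k$, $\{z^k\}_k$ be generated by the normal map-based stochastic proximal gradient method described in the context and suppose conditions (A.1), (A.2), (A.3) and (B.1) hold. Assume moreover $\alpha_k\in(0,\mathsf T/5]$ for all $k\in\mathbb N$. Then for all $k\ge1$, \[ \min_{i=0,\dots,k-1}\mathbb E[\|F^\lambda_{\mathrm{nat}}(x^i)\|^2]\le\frac{D_1[H_\xi(z^0)-\bar\psi]}{\sum_{i=0}^{k-1}\alpha_i}+\frac{D_2\sum_{i=0}^{k-1}\alpha_i^2\sigma_i^2}{\sum_{i=0}^{k-1}\alpha_i}, \] where $D_1:=10(1+\lambda\bar\lambda)^2\lambda^2\xi^{-1}$ and $D_2:=\max\{200(1+\lambda\bar\lambda)^2\lambda^2(\mathsf T\xi)^{-1},\,8\lambda^2\bar\lambda^2\mathsf T\}$.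
   Context: Let $\varphi:\mathbb{R}^d\to(-\infty,\infty]$ be convex, lower semicontinuous and proper, let $f:\mathbb{R}^d\to\mathbb{R}$ be continuously differentiable, and set $\psi=f+\varphi$. For $\lambda>0$ let $\mathrm{prox}_{\lambda\varphi}(x)=\operatorname{argmin}_y\{\varphi(y)+\frac{1}{2\lambda}\|x-y\|^2\}$, $\mathrm{env}_{\lambda\varphi}$ the Moreau envelope with $\nabla\mathrm{env}_{\lambda\varphi}(x)=(x-\mathrm{prox}_{\lambda\varphi}(x))/\lambda$, $F^\lambda_{\mathrm{nor}}(z)=\nabla f(\mathrm{prox}_{\lambda\varphi}(z))+\frac1\lambda(z-\mathrm{prox}_{\lambda\varphi}(z))$, $F^\lambda_{\mathrm{nat}}(x)=x-\mathrm{prox}_{\lambda\varphi}(x-\lambda\nabla f(x))$, and the merit function $H_\xi(z)=\psi(\mathrm{prox}_{\lambda\varphi}(z))+\frac{\xi\lambda}2\|F^\lambda_{\mathrm{nor}}(z)\|^2$. Method: on a filtered probability space $(\Omega,\mathcal F,\{\mathcal F_k\}_k,\mathbb P)$, with $\lambda>0$, step sizes $\alpha_k>0$, deterministic $z^0$, $x^0=\mathrm{prox}_{\lambda\varphi}(z^0)$, and $\mathcal F_{k+1}$-measurable random vectors $g^k$, set $z^{k+1}=z^k-\alpha_k(g^k+\nabla\mathrm{env}_{\lambda\varphi}(z^k))$, $x^{k+1}=\mathrm{prox}_{\lambda\varphi}(z^{k+1})$. Let $e^k=g^k-\nabla f(x^k)$. Conditions: (A.1) There is $\bar\psi\in\mathbb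 R$ with $\psi\ge\bar\psi$ on $\mathrm{dom}\,\varphi$. (A.2) $\mathbb E[g^k\mid\mathcal F_k]=\nabla f(x^k)$ a.s. and there is $\{\sigma_k\}_k\subseteq\mathbb R_+$ with $\mathbb E[\|e^k\|^2]\le\sigma_k^2$ for all $k$. (A.3) $\sum_k\alpha_k=\infty$ and $\alpha_k\to0$. (B.1) $\nabla f$ is Lipschitz continuous on $\mathbb R^d$ with modulus $\mathsf L>0$. Constants: $\xi:=(2+2\mathsf L^2\lambda^2)^{-1}$, $\bar\lambda:=(\mathsf L+2\lambda^{-1})\exp(\mathsf L\lambda+2)$, and $\mathsf T:=\sup\{t\ge0:\ t\le\min\{\tfrac{4\lambda}5,1\},\ \tfrac1{2t}\ge\xi(4\mathsf L-\lambda^{-1})+\mathsf L,\ \mathsf L\bar\lambda^2t^2+5\bar\lambda^2t\le\tfrac{8\xi}{25\lambda},\ [\tfrac5t+\mathsf L](1+\bar\lambda t)^2\le\tfrac{10}t\}$. *)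

(* Defs.v *)
From HB Require Import structures.
From mathcomp Require Import all_boot all_order all_algebra.
From mathcomp Require Import all_classical all_reals all_analysis.
Set Implicit Arguments. Unset Strict Implicit. Unset Printing Implicit Defensive.
Import Order.TTheory GRing.Theory Num.Theory.
Import numFieldNormedType.Exports.
Local Open Scope classical_set_scope.
Local Open Scope ring_scope.

Section VecDefs.
Variables (R : realType) (d : nat).
Local Notation V := 'rV[R]_d.

Definition dotv (u v : V) : R := \sum_(i < d) u ord0 i * v ord0 i.
Definition sqnorm (v : V) : R := dotv v v.
Definition norm2 (v : V) : R := Num.sqrt (sqnorm v).

Definition grad (f : V -> R) (x : V) : V :=
  \row_(i < d) derive f x (delta_mx ord0 i).

Definition C1 (f : V -> R) : Prop :=
  (forall x, differentiable f x) /\ continuous (grad f).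

Definition lipschitz_vf (G : V -> V) (L : R) : Prop :=
  forall x y, norm2 (G x - G y) <= L * norm2 (x - y).

Definition proper_fun (phi : V -> \bar R) : Prop :=
  (exists x, phi x < +oo)%E /\ (forall x, -oo < phi x)%E.
Definition convex_fun (phi : V -> \bar R) : Prop :=
  forall (x y : V) (t : R), 0 <= t <= 1 ->
    (phi (t *: x + (1 - t) *: y)%R <= t%:E * phi x + (1 - t)%:E * phi y)%E.
Definition lsc_fun (phi : V -> \bar R) : Prop :=
  forall a : R, closed [set x | (phi x <= a%:E)%E].
Definition domf (phi : V -> \bar R) : set V := [set x | (phi x < +oo)%E].

(** Proximal operator: the (unique, under the standing assumptions) minimizer. *)
Definition prox_obj (lam : R) (phi : V -> \bar R) (x y : V) : \bar R :=
  (phi y + ((2 * lam)^-1 * sqnorm (x - y))%:E)%E.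
Definition prox (lam : R) (phi : V -> \bar R) (x : V) : V :=
  xget 0 [set y | forall w, (prox_obj lam phi x y <= prox_obj lam phi x w)%E].

Definition grad_env (lam : R) (phi : V -> \bar R) (x : V) : V :=
  lam^-1 *: (x - prox lam phi x).
Definition Fnor (f : V -> R) (lam : R) (phi : V -> \bar R) (z : V) : V :=
  grad f (prox lam phi z) + lam^-1 *: (z - prox lam phi z).
Definition Fnat (f : V -> R) (lam : R) (phi : V -> \bar R) (x : V) : V :=
  x - prox lam phi (x - lam *: grad f x).
Definition Hxi (f : V -> R) (phi : V -> \bar R) (lam xi : R) (z : V) : \bar R :=
  ((f (prox lam phi z))%:E + phi (prox lam phi z)
   + ((xi * lam / 2) * sqnorm (Fnor f lam phi z))%:E)%E.

End VecDefs.

Section Consts.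
Variable R : realType.
Definition xi_c (L lam : R) : R := (2 + 2 * L ^+ 2 * lam ^+ 2)^-1.
Definition lambar_c (L lam : R) : R := (L + 2 * lam^-1) * expR (L * lam + 2).
Definition T_c (L lam : R) : R :=
  let xi := xi_c L lam in let lb := lambar_c L lam in
  sup [set t : R | [/\ 0 < t, t <= Num.min (4 * lam / 5) 1,
        xi * (4 * L - lam^-1) + L <= (2 * t)^-1,
        L * lb ^+ 2 * t ^+ 2 + 5 * lb ^+ 2 * t <= 8 * xi / (25 * lam) &
        (5 / t + L) * (1 + lb * t) ^+ 2 <= 10 / t]].
Definition D1_c (L lam : R) : R :=
  10 * (1 + lam * lambar_c L lam) ^+ 2 * lam ^+ 2 * (xi_c L lam)^-1.
Definition D2_c (L lam : R) : R :=
  Num.max (200 * (1 + lam * lambar_c L lam) ^+ 2 * lam ^+ 2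
             * (T_c L lam * xi_c L lam)^-1)
          (8 * lam ^+ 2 * lambar_c L lam ^+ 2 * T_c L lam).
End Consts.

Section Prob.
Context {dT : measure_display} {T : measurableType dT} {R : realType}.

Definition measurable_wrt (G : set (set T)) (X : T -> R) : Prop :=
  forall B : set R, measurable B -> G (X @^-1` B).

Definition filtration (F : nat -> set (set T)) : Prop :=
  forall k, [/\ sigma_algebra setT (F k), F k `<=` measurable & F k `<=` F k.+1].

Definition rvec_measurable_wrt {d : nat} (G : set (set T)) (X : T -> 'rV[R]_d) :=
  forall i : 'I_d, measurable_wrt G (fun w => X w ord0 i).

Definition cond_exp_is (P : probability T R) {d : nat} (G : set (set T))
    (X Y : T -> 'rV[R]_d) : Prop :=
  forall i : 'I_d,
    [/\ P.-integrable setT (fun w => (X w ord0 i)%:E),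
        P.-integrable setT (fun w => (Y w ord0 i)%:E),
        measurable_wrt G (fun w => Y w ord0 i) &
        forall A, G A ->
          (\int[P]_(w in A) (X w ord0 i)%:E = \int[P]_(w in A) (Y w ord0 i)%:E)%E].
End Prob.

(* Main.v *)
Require Import Defs.
From HB Require Import structures.
From mathcomp Require Import all_boot all_order all_algebra.
From mathcomp Require Import all_classical all_reals all_analysis.
From mathcomp Require Import measurable_realfun.
From mathcomp Require Import ring lra zify.
Set Implicit Arguments. Unset Strict Implicit. Unset Printing Implicit Defensive.
Import Order.TTheory GRing.Theory Num.Theory.
Import numFieldNormedType.Exports.
Local Open Scope classical_set_scope.
Local Open Scope ring_scope.

(* Write G for the normal map, so that z' = z - alpha (G z + e).  Over a window
   [m, n) of accumulated step size tau of order T the iterates satisfy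
   z_n - z_m = - tau G(z_m) + E, where E gathers the noise S = sum alpha_j e_j
   and the variation of G, which is Lipschitz; as tau is small, E is absorbed
   up to |S|^2 terms.  The merit function then decreases by a multiple of
   tau |G(z_m)|^2 up to |S|^2 / tau, for every realization of the noise.
   Partition [0, k) into windows whose step sizes add up to about T/5, sum the
   inequalities and take expectations: martingale increments being orthogonal,
   E|S|^2 <= sum alpha_j^2 sigma_j^2.  The points z_m at the starts of the windows,
   weighted by tau, carry the total weight sum alpha_i, and
   |Fnat(x_m)| <= lam |G(z_m)|, whence the bound on the minimum. *)

(** Why windows: with a window of a single step the noise term [|S|^2 / tau] would be
    [|alpha e|^2 / alpha = alpha |e|^2], and summation would produce [alpha sigma^2] instead of
    [alpha^2 sigma^2]. Over a window with [tau >= T/5] the factor [1 / tau] is at most [5 / T],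
    while orthogonality keeps [E|S|^2] at the sum of the [alpha^2 sigma^2]; this is the source of
    the [1 / T] in [D2]. Why pathwise: the proximal point reached at the end of a window depends
    nonlinearly on the noise, so no conditional expectation is taken of the merit function. The
    descent inequality holds for each outcome, and the probability enters only through [E|S|^2]. The
    windows depend on the step sizes alone, so the same windows serve all outcomes. Expectations of
    [|Fnat|^2] are handled as lower integrals: monotonicity and superadditivity, valid without
    measurability, go in the direction needed here. *)

(** * Euclidean inner product and elementary inequalities *)

Section EuclideanSpace.
Variables (R : realType) (d : nat).
Implicit Types (u v w : 'rV[R]_d) (a c : R).

Lemma dotvC u v : dotv u v = dotv v u.
Proof. by apply: eq_bigr => i _; rewrite mulrC. Qed.

Lemma dotvDl u v w : dotv (u + v) w = dotv u w + dotv v w.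
Proof. by rewrite -big_split; apply: eq_bigr => i _; rewrite mxE mulrDl. Qed.

Lemma dotvZl a u v : dotv (a *: u) v = a * dotv u v.
Proof. by rewrite mulr_sumr; apply: eq_bigr => i _; rewrite mxE mulrA. Qed.

Lemma dotvNl u v : dotv (- u) v = - dotv u v.
Proof. by rewrite -scaleN1r dotvZl mulN1r. Qed.

Lemma dotvDr u v w : dotv u (v + w) = dotv u v + dotv u w.
Proof. by rewrite dotvC dotvDl !(dotvC u). Qed.

Lemma dotvZr a u v : dotv u (a *: v) = a * dotv u v.
Proof. by rewrite dotvC dotvZl dotvC. Qed.

Lemma dotvNr u v : dotv u (- v) = - dotv u v.
Proof. by rewrite dotvC dotvNl dotvC. Qed.

Definition dotvE := (dotvDl, dotvDr, dotvNl, dotvNr, dotvZl, dotvZr).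

Lemma sqnorm_ge0 u : 0 <= sqnorm u.
Proof. by apply: sumr_ge0 => i _; rewrite -expr2 sqr_ge0. Qed.

Lemma sqnormN u : sqnorm (- u) = sqnorm u.
Proof. by rewrite /sqnorm dotvNl dotvNr opprK. Qed.

Lemma sqnormZ a u : sqnorm (a *: u) = a ^+ 2 * sqnorm u.
Proof. by rewrite /sqnorm dotvZl dotvZr mulrA expr2. Qed.

Lemma sqnormD u v : sqnorm (u + v) = sqnorm u + 2 * dotv u v + sqnorm v.
Proof. by rewrite /sqnorm !dotvE (dotvC v u); ring. Qed.

Lemma sqnormB u v : sqnorm (u - v) = sqnorm u - 2 * dotv u v + sqnorm v.
Proof. by rewrite sqnormD sqnormN dotvNr; ring. Qed.

Lemma sqnorm0 : sqnorm (0 : 'rV[R]_d) = 0.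
Proof. by rewrite -(scale0r 0) sqnormZ expr2 !mul0r. Qed.

Lemma sqr_coord_le u i : u ord0 i ^+ 2 <= sqnorm u.
Proof.
rewrite /sqnorm /dotv (bigD1 i) //= -expr2 lerDl.
by apply: sumr_ge0 => j _; rewrite -expr2 sqr_ge0.
Qed.

Lemma young_dotv c u v :
  0 < c -> 2 * dotv u v <= c * sqnorm u + c^-1 * sqnorm v.
Proof.
move=> c0; have := sqnorm_ge0 (c *: u - v).
rewrite sqnormB sqnormZ dotvZl => h.
rewrite -(ler_pM2l c0) mulrDr !mulrA divff ?gt_eqF //; lra.
Qed.

Lemma sqnormD_le2 u v : sqnorm (u + v) <= 2 * sqnorm u + 2 * sqnorm v.
Proof. rewrite sqnormD; have := @young_dotv 1 u v ltr01; lra. Qed.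

Lemma sqnormD_le3 u v w :
  sqnorm (u + v + w) <= 3 * sqnorm u + 3 * sqnorm v + 3 * sqnorm w.
Proof.
rewrite !sqnormD dotvDl; have := @young_dotv 1 u v ltr01.
have := @young_dotv 1 u w ltr01; have := @young_dotv 1 v w ltr01; lra.
Qed.

(** Jensen's inequality with unnormalized weights. In the induction the cross term between [v i] and
    the tail sum [S] is split by Young with parameter [s], the weight of the tail, and the
    hypothesis controls [s^-1 * sqnorm S]. *)
Lemma sqnorm_sum_le (I : Type) (r : seq I) (a : I -> R) (v : I -> 'rV[R]_d) :
  (forall i, 0 < a i) ->
  sqnorm (\sum_(i <- r) a i *: v i) <=
  (\sum_(i <- r) a i) * \sum_(i <- r) a i * sqnorm (v i).
Proof.
move=> a0; elim: r => [|i r IH]; first by rewrite !big_nil sqnorm0 mul0r.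
rewrite !big_cons.
(* A nonempty tail is separated off because Young needs [s > 0]. *)
case: r IH => [|j r] IH; first by rewrite !big_nil !addr0 sqnormZ; lra.
have s0 : 0 < \sum_(l <- j :: r) a l.
  by rewrite big_cons ltr_pwDl // sumr_ge0 // => l _; exact: ltW.
move: IH; move: s0; set s := \sum_(l <- j :: r) a l; set q := \sum_(l <- _) a l * _.
set S := \sum_(l <- _) a l *: v l => s0 IH.
rewrite sqnormD sqnormZ dotvZl.
have /(ler_wpM2l (ltW (a0 i))) := @young_dotv (s) (v i) S s0.
have s1 : s^-1 * sqnorm S <= q by rewrite ler_pdivrMl.
have /(ler_wpM2l (ltW (a0 i))) := s1.
nra.
Qed.

Lemma lipschitz_sqnorm (G : 'rV[R]_d -> 'rV[R]_d) (L : R) : 0 < L ->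
  lipschitz_vf G L -> forall u v, sqnorm (G u - G v) <= L ^+ 2 * sqnorm (u - v).
Proof.
move=> L0 GL u v; have := GL u v; rewrite /norm2 => h.
rewrite -(sqr_sqrtr (sqnorm_ge0 (G u - G v))) -(sqr_sqrtr (sqnorm_ge0 (u - v))).
by rewrite -exprMn ler_sqr // nnegrE ?mulr_ge0 ?sqrtr_ge0 // ltW.
Qed.

End EuclideanSpace.

(** * Quadratic upper bound for a function with Lipschitz gradient *)

Section DescentLemma.
Variables (R : realType) (d : nat) (f : 'rV[R]_d -> R).
Hypothesis df : forall x, differentiable f x.

Lemma diff_grad x q : 'd f x q = dotv (grad f x) q.
Proof.
rewrite {1}(row_sum_delta q) linear_sum /dotv; apply: eq_bigr => i _.
by rewrite linearZ /= mxE -deriveE // mulrC.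
Qed.

Lemma is_derive_line x q (t : R) :
  is_derive t 1 (fun s : R => f (x + s *: q)) (dotv (grad f (x + t *: q)) q).
Proof.
have dg : is_diff t (fun s : R => x + s *: q) (fun s => s *: q).
  have -> : (fun s : R => s *: q) = 0 + (fun s : R => s *: q).
    by apply/funext => s; rewrite /= add0r.
  have -> : (fun s : R => x + s *: q) = cst x + (fun s : R => s *: q) by [].
  apply: is_diffD.
have dfg : differentiable (f \o (fun s : R => x + s *: q)) t.
  exact: differentiable_comp.
apply: DeriveDef; first exact/derivable1_diffP.
rewrite -derive1E derive1E' // diff_comp //= diff_val scale1r.
exact: diff_grad.
Qed.

(** Rather than integrating the gradient along the segment, apply the mean value theorem to [h], the
    gap between [f] on the segment and the claimed quadratic; it remains to check the sign of [h']
    at one point. *)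
Lemma descent_lemma (L : R) : 0 < L -> lipschitz_vf (grad f) L ->
  forall x y, f y <= f x + dotv (grad f x) (y - x) + L / 2 * sqnorm (y - x).
Proof.
move=> L0 fL x y; set q := y - x.
pose h (t : R) := f (x + t *: q) - (t * dotv (grad f x) q + L / 2 * sqnorm q * t ^+ 2).
pose h' (t : R) := dotv (grad f (x + t *: q)) q - (dotv (grad f x) q + L * sqnorm q * t).
have dh (s : R) : is_derive s 1 h (h' s).
  rewrite /h /h'; have H := is_derive_line x q s.
  apply: is_deriveB.
  apply: is_derive_eq; by rewrite /GRing.scale /=; field.
have ch (s : R) : {for s, continuous h}.
  apply/differentiable_continuous/derivable1_diffP; exact: ex_derive.
have [c /[!in_itv] /andP[c0 _]] : exists2 c, c \in `]0, 1[ & h 1 - h 0 = h' c * (1 - 0).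
  apply: MVT => //.
  by apply: continuous_subspaceT => s; exact: ch.
rewrite subr0 mulr1 => h10.
suff : h' c <= 0.
  have xq : x + q = y by rewrite addrC subrK.
  move: h10; rewrite /h scale1r xq scale0r addr0; lra.
(* With Young parameter [(c * L)^-1] both resulting terms are at most [c * L * sqnorm q], exactly
   what [h'] subtracts. *)
have cL : 0 < c * L by rewrite mulr_gt0.
have cL' : 0 < (c * L)^-1 by rewrite invr_gt0.
have := young_dotv (grad f (x + c *: q) - grad f x) q cL'.
rewrite invrK dotvDl dotvNl.
have := lipschitz_sqnorm L0 fL (x + c *: q) x.
rewrite addrAC subrr add0r sqnormZ.
set A := sqnorm (_ - _) => hA.
have : (c * L)^-1 * A <= c * L * sqnorm q.
  by rewrite ler_pdivrMl //; apply: le_trans hA _; rewrite le_eqVlt; apply/orP; left; apply/eqP; ring.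
rewrite /h'; lra.
Qed.
End DescentLemma.

(** * Convergence of sequences with a Euclidean Cauchy rate *)

Section Completeness.
Variables (R : realType) (d : nat).
Implicit Types (u : nat -> 'rV[R]_d) (x l : 'rV[R]_d).

Lemma cvg_sqnormB x u l :
  u @ \oo --> l -> (fun n => sqnorm (x - u n)) @ \oo --> sqnorm (x - l).
Proof.
move=> ul; rewrite /sqnorm /dotv.
elim: (index_enum _) => [|i r IH].
  by rewrite big_nil; under eq_fun do rewrite big_nil; exact: cvg_cst.
rewrite big_cons; under eq_fun do rewrite big_cons.
have ci : (fun n => (x - u n) ord0 i) @ \oo --> (x - l) ord0 i.
  rewrite !mxE; under eq_fun do rewrite !mxE.
  apply: cvgB; first exact: cvg_cst.
  have := @coord_continuous R 1 d ord0 i l; exact: cvg_comp.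
by apply: cvgD => //; exact: cvgM.
Qed.

Lemma sqnorm_cauchy_cvg u (C : R) : 0 < C ->
  (forall m n, (m <= n)%N -> sqnorm (u m - u n) <= C / m.+1%:R) ->
  exists l, u @ \oo --> l.
Proof.
move=> C0 uC; suff : cvg (u @ \oo) by move=> h; exists (lim (u @ \oo)).
suff : cauchy (u @ \oo).
  exact: (@mx_complete R 1 d).
apply: cauchy_exP => e e0.
have [N _ NC] := near_infty_natSinv_lt (PosNum (divr_gt0 (exprn_gt0 2 e0) C0)).
exists (u N); exists N => // n /= Nn; split=> // i j; rewrite (ord1 i) /ball /=.
have := le_lt_trans (le_trans (sqr_coord_le (u N - u n) j) (uC _ _ Nn)).
move=> /(_ (e ^+ 2)); rewrite !mxE => h.
rewrite -(ltr_pXn2r (n:=2)) ?nnegrE ?normr_ge0 ?ltW // real_normK ?num_real //.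
apply: h; have := NC N (leqnn N); rewrite /= ltr_pdivlMr //.
by rewrite mulrC.
Qed.

End Completeness.

(** * Existence, subgradient inequality and nonexpansiveness of the proximal map *)

Section ProximalOperator.
Variables (R : realType) (d : nat) (phi : 'rV[R]_d -> \bar R) (lam : R).
Hypotheses (lam0 : 0 < lam) (cphi : convex_fun phi) (lphi : lsc_fun phi).
Hypothesis pphi : proper_fun phi.
Hypothesis bphi : forall x0, exists B : R,
  forall y, sqnorm (y - x0) <= 1 -> (B%:E <= phi y)%E.
Implicit Types (x y w : 'rV[R]_d) (a b t : R).

Lemma phi_fin y : (phi y < +oo)%E -> exists a, phi y = a%:E.
Proof.
move=> yoo; exists (fine (phi y)); rewrite fineK // fin_numE.
by rewrite (gt_eqF (pphi.2 y)) (lt_eqF yoo).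
Qed.

Lemma convex_phi_fin x y a b t : phi x = a%:E -> phi y = b%:E -> 0 <= t <= 1 ->
  (phi (t *: x + (1 - t) *: y) <= (t * a + (1 - t) * b)%:E)%E.
Proof. by move=> xa yb t01; rewrite EFinD !EFinM -xa -yb; exact: cphi. Qed.

Let q x y := (2 * lam)^-1 * sqnorm (x - y).

(** The local bound [bphi] takes the place of an affine minorant: convexity along segments from a
    point [y0] of the domain propagates it to a lower bound that is affine in [|y - y0|], and the
    quadratic term dominates it. *)
Lemma prox_obj_lbound x :
  exists m : R, forall y b, phi y = b%:E -> m <= b + q x y.
Proof.
have [y0 y0oo] := pphi.1; have [v v0] := phi_fin y0oo.
have [B HB] := bphi y0; pose c := B - v.
(* The affine bound will be [b >= B + c * r]. Completing the square in [r ^+ 2 / (4 * lam) + c * r]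
   costs [lam * c ^+ 2], and passing from [|x - y|] to [r] costs [q x y0]. *)
exists (B - lam * c ^+ 2 - q x y0) => y b yb.
have r0 : 0 <= norm2 (y - y0) by exact: sqrtr_ge0.
have rE : norm2 (y - y0) ^+ 2 = sqnorm (y - y0) by rewrite sqr_sqrtr ?sqnorm_ge0.
set r := norm2 _ in r0 rE.
have r1 : 0 < 1 + r by lra.
(* This weight brings the convex combination of [y] and [y0] into the unit ball around [y0], where
   [B] applies. *)
pose t := (1 + r)^-1.
have t0 : 0 < t by rewrite invr_gt0.
have tr : t * (1 + r) = 1 by rewrite mulVf ?gt_eqF.
have t1 : t <= 1 by rewrite -tr ler_peMr ?(ltW t0) //; lra.
have tr1 : t * r <= 1 by lra.
have := HB (t *: y + (1 - t) *: y0).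
have -> : t *: y + (1 - t) *: y0 - y0 = t *: (y - y0).
  by apply/rowP => k; rewrite !mxE; ring.
rewrite sqnormZ -rE -exprMn expr_le1 // ?mulr_ge0 ?(ltW t0) // => /(_ tr1) h.
have t01 : 0 <= t <= 1 by rewrite (ltW t0).
have := le_trans h (convex_phi_fin yb v0 t01); rewrite lee_fin => h2.
have h3 : B * (1 + r) <= b + r * v.
  have := ler_wpM2r (ltW r1) h2.
  have -> : (t * b + (1 - t) * v) * (1 + r) = (t * (1 + r)) * b + (1 + r - t * (1 + r)) * v by ring.
  by rewrite tr => h4; apply: le_trans h4 _; lra.
have h5 : r ^+ 2 <= 2 * sqnorm (x - y) + 2 * sqnorm (x - y0).
  rewrite rE; have := sqnormD_le2 (y - x) (x - y0).
  by rewrite addrA subrK -(sqnormN (y - x)) opprB.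
have l0 : 0 < (2 * lam)^-1 by rewrite invr_gt0 mulr_gt0.
have ll : (2 * lam)^-1 * lam = 2^-1 by field; rewrite gt_eqF.
have h6 : 0 <= (2 * lam)^-1 * (r / 2 + lam * c) ^+ 2 * 2.
  by rewrite mulr_ge0 // mulr_ge0 ?sqr_ge0 // ltW.
have h7 : (2 * lam)^-1 * (r / 2 + lam * c) ^+ 2 * 2 =
  (2 * lam)^-1 * r ^+ 2 / 2 + ((2 * lam)^-1 * lam * 2) * r * c +
  ((2 * lam)^-1 * lam * 2) * lam * c ^+ 2 by field; rewrite gt_eqF.
have := ler_wpM2l (ltW l0) h5; rewrite /q.
rewrite h7 ll in h6; rewrite /c in h6 *; lra.
Qed.

(** Direct method without compactness: by the parallelogram identity at midpoints, strong convexity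
    of [q x] makes a minimizing sequence Cauchy, and lower semicontinuity passes to its limit. *)
Lemma prox_exists x :
  exists p, forall w, (prox_obj lam phi x p <= prox_obj lam phi x w)%E.
Proof.
pose E := [set r | exists y b, phi y = b%:E /\ r = b + q x y].
have [B HB] := prox_obj_lbound x.
have [y0 y0oo] := pphi.1; have [v v0] := phi_fin y0oo.
have lE : has_lbound E by exists B => _ [y [b [yb ->]]]; exact: HB.
have iE : has_inf E by split => //; exists (v + q x y0), y0, v.
pose m := inf E.
have mE y b : phi y = b%:E -> m <= b + q x y by move=> yb; apply: ge_inf => //; exists y, b.
have /choice[u Hu] : forall n : nat, exists y, exists b,
    phi y = b%:E /\ b + q x y <= m + n.+1%:R^-1.
  move=> n; have n0 : 0 < n.+1%:R^-1 :> R by rewrite invr_gt0.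
  by have [_ [y [b [yb ->]]] /ltW h] := inf_adherent n0 iE; exists y, b.
(* Both objective values exceed [m] by at most [1 / (i + 1)] and the midpoint value is at least [m],
   so [(2 * lam)^-1 * sqnorm (u i - u j) / 4] is at most [1 / (i + 1)]. *)
have uC i j : (i <= j)%N -> sqnorm (u i - u j) <= (8 * lam) / i.+1%:R.
  move=> ij; have [a [ia Ha]] := Hu i; have [b [jb Hb]] := Hu j.
  have h12 : 0 <= (2^-1 : R) <= 1 by apply/andP; split; lra.
  have := convex_phi_fin ia jb h12; set w := _ + _ => hw.
  have [c wc] := phi_fin (le_lt_trans hw (ltry _)).
  move: hw; rewrite wc lee_fin => hw.
  have := mE _ _ wc.
  have qw : q x w = (q x (u i) + q x (u j)) / 2 - (2 * lam)^-1 * sqnorm (u i - u j) / 4.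
    rewrite /q; have -> : x - w = 2^-1 *: (x - u i) + 2^-1 *: (x - u j).
      by apply/rowP => k; rewrite !mxE; field.
    have -> : u i - u j = (x - u j) - (x - u i) by apply/rowP => k; rewrite !mxE; ring.
    move: (x - u i) (x - u j) => A A'.
    by rewrite !sqnormD sqnormN !sqnormZ !dotvE (dotvC A'); field; rewrite gt_eqF.
  have ji : j.+1%:R^-1 <= i.+1%:R^-1 :> R by rewrite lef_pV2 ?posrE // ler_nat.
  rewrite qw => h; move: Ha Hb.
  move: ji; set I := i.+1%:R^-1; set J := j.+1%:R^-1 => ji Ha Hb.
  have : (2 * lam)^-1 * sqnorm (u i - u j) <= 4 * I by lra.
  rewrite ler_pdivrMl ?mulr_gt0 //; lra.
have C0 : 0 < 8 * lam by rewrite mulr_gt0.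
have [p up] := sqnorm_cauchy_cvg C0 uC.
(* Since [q x (u n)] tends to [q x p], the sequence eventually lies in this sublevel set of [phi],
   which is closed. *)
have key e : 0 < e -> (phi p <= (m + e - q x p)%:E)%E.
  move=> e0; have e2 : 0 < e / 2 by rewrite divr_gt0.
  suff : \forall n \near \oo, [set y | (phi y <= (m + e - q x p)%:E)%E] (u n).
    by move=> h; exact: (closed_cvg _ (@lphi (m + e - q x p)) h p up).
  have qu : (fun n => q x (u n)) @ \oo --> q x p.
    by apply: cvgM; [exact: cvg_cst|exact: cvg_sqnormB].
  near=> n.
  have [b [ub Hb]] := Hu n; rewrite /= ub lee_fin.
  have h1 : n.+1%:R^-1 < e / 2 by near: n; exact: (near_infty_natSinv_lt (PosNum e2)).
  have h2 : `|q x p - q x (u n)| < e / 2 by near: n; move/cvgr_dist_lt : qu; exact.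
  have := ler_norm (q x p - q x (u n)).
  move: Hb h1; set I := n.+1%:R^-1 => Hb h1; lra.
have [b pb] := phi_fin (le_lt_trans (key 1 ltr01) (ltry _)).
exists p => w; rewrite /prox_obj -!/(q _ _) pb.
have [->|w0] := eqVneq (phi w) +oo%E; first by rewrite addye ?ltNyr // leey.
have [c wc] : exists c, phi w = c%:E by apply: phi_fin; rewrite lt_neqAle w0 leey.
rewrite wc -!EFinD lee_fin; apply: le_trans (mE _ _ wc).
apply/ler_addgt0Pr => e /key; rewrite pb lee_fin; lra.
Unshelve. all: by end_near.
Qed.

Lemma prox_min x w :
  (prox_obj lam phi x (prox lam phi x) <= prox_obj lam phi x w)%E.
Proof.
have [p Hp] := prox_exists x.
by rewrite /prox; case: xgetP => [y _ -> // | /(_ p)].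
Qed.

Lemma phi_prox_fin x : exists a, phi (prox lam phi x) = a%:E.
Proof.
have [y0 y0oo] := pphi.1; have [v v0] := phi_fin y0oo.
apply: phi_fin; have := prox_min x y0; rewrite /prox_obj v0 -EFinD.
by case: (phi _) => // r; rewrite ?ltry.
Qed.

(** That is, [lam^-1 *: (x - prox x)] is a subgradient at the proximal point: compare it with the
    points [p + t (w - p)], divide by [t] and let [t] tend to 0. *)
Lemma prox_subgradient x w a b : phi (prox lam phi x) = a%:E -> phi w = b%:E ->
  a + lam^-1 * dotv (x - prox lam phi x) (w - prox lam phi x) <= b.
Proof.
set p := prox lam phi x => pa wb.
have h t : 0 < t <= 1 -> a + lam^-1 * dotv (x - p) (w - p) <=
    b + t * ((2 * lam)^-1 * sqnorm (w - p)).
  move=> /andP[t0 t1]; have t01 : 0 <= t <= 1 by rewrite (ltW t0).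
  have := convex_phi_fin wb pa t01; set y := _ + _ => hy.
  have [c yc] := phi_fin (le_lt_trans hy (ltry _)).
  move: hy; rewrite yc lee_fin => hy.
  have := prox_min x y; rewrite /prox_obj -/p pa yc -!EFinD lee_fin.
  have -> : x - y = (x - p) - t *: (w - p).
    by rewrite /y; apply/rowP => k; rewrite !mxE; ring.
  move: (x - p) (w - p) => u v; rewrite sqnormB sqnormZ dotvZr => h.
  rewrite -(ler_pM2l t0).
  have -> : t * (a + lam^-1 * dotv u v) =
    t * a + (2 * lam)^-1 * (2 * (t * dotv u v)) by field; rewrite gt_eqF.
  lra.
apply/ler_addgt0Pr => e e0.
have s0 : 0 <= (2 * lam)^-1 * sqnorm (w - p).
  by rewrite mulr_ge0 ?sqnorm_ge0 // invr_ge0 mulr_ge0 // ltW.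
set s := _ * sqnorm _ in h s0.
(* The limit is taken by hand: this [t] gives [t * s <= e], and [s + 1] avoids dividing by a
   vanishing [s]. *)
pose t := Num.min 1 (e / (s + 1)).
have t0 : 0 < t by rewrite lt_min ltr01 divr_gt0 //; lra.
have t1 : t <= 1 by rewrite ge_min lexx.
have ts : t * (s + 1) <= e by rewrite -ler_pdivlMr ?ge_min ?lexx ?orbT //; lra.
have := h t; rewrite t0 t1 => /(_ isT) ht; apply: (le_trans ht); lra.
Qed.

(* Sum of the subgradient inequalities at the two points. *)
Lemma prox_firmly_nonexpansive x y :
  sqnorm (prox lam phi x - prox lam phi y) <=
  dotv (prox lam phi x - prox lam phi y) (x - y).
Proof.
have [a pa] := phi_prox_fin x; have [b pb] := phi_prox_fin y.
have := prox_subgradient pa pb; have := prox_subgradient pb pa.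
set p := prox _ _ x; set p' := prox _ _ y => h1 h2.
have l0 : 0 < lam^-1 by rewrite invr_gt0.
have : lam^-1 * (sqnorm (p - p') - dotv (p - p') (x - y)) <= 0.
  have -> : sqnorm (p - p') - dotv (p - p') (x - y) =
    dotv (y - p') (p - p') + dotv (x - p) (p' - p).
    by rewrite /sqnorm !dotvE !(dotvC _ x) !(dotvC _ y) (dotvC p' p); ring.
  lra.
by rewrite pmulr_rle0 // subr_le0.
Qed.

Lemma prox_nonexpansive x y :
  sqnorm (prox lam phi x - prox lam phi y) <= sqnorm (x - y).
Proof.
have := prox_firmly_nonexpansive x y.
have := young_dotv (prox lam phi x - prox lam phi y) (x - y) ltr01; lra.
Qed.

End ProximalOperator.

(** * The scalar inequality behind the decrease of the merit function *)

Section MeritDescent.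
Variables (R : realType) (d : nat).
Implicit Types (u v q h a E G : 'rV[R]_d) (xi lam L tau : R).

(* The absorption constants for [|q|^2 / tau], [xi tau |G|^2] and [|E|^2 / tau]
   come from splitting [<E, q>], [<G, a>] and [<G, E>] by Young's inequality. *)
Lemma merit_increment_le xi lam L tau G q h a E :
  0 < lam -> 0 < L -> 0 < tau -> xi * (2 + 2 * L ^+ 2 * lam ^+ 2) = 1 ->
  1000 * tau <= xi * lam -> h = - tau *: G + E ->
  sqnorm q <= dotv q h -> sqnorm a <= L ^+ 2 * sqnorm q ->
  dotv G q + lam^-1 * dotv h q - lam^-1 * sqnorm q + L / 2 * sqnorm q
    + xi * lam / 2 * (sqnorm (G + (a + lam^-1 *: (h - q))) - sqnorm G)
  <= - (2 / 5 * (xi * tau * sqnorm G)) + 2 * (tau^-1 * sqnorm E).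
Proof.
move=> lam0 L0 tau0 xiE tl hE firm aL.
have hq : dotv h q = - tau * dotv G q + dotv E q by rewrite hE !dotvE.
have Gh : dotv G h = - tau * sqnorm G + dotv G E by rewrite hE !dotvE.
have HH : sqnorm h <= 2 * (tau ^+ 2 * sqnorm G) + 2 * sqnorm E.
  by rewrite hE (le_trans (sqnormD_le2 _ _)) // sqnormZ sqrrN.
have c1 : 0 < 9 / 10 :> R by lra.
have yEq := young_dotv q E c1.
have c2 : 0 < tau / lam by rewrite divr_gt0.
have yGa := young_dotv G a c2.
have c3 : 0 < 19 / 100 * tau by rewrite mulr_gt0 //; lra.
have yGE := young_dotv G E c3.
have N := sqnormD_le2 a (lam^-1 *: (h - q)).
have [G0 [q0 [E0 a0]]] : 0 <= sqnorm G /\ 0 <= sqnorm q /\ 0 <= sqnorm E /\ 0 <= sqnorm a.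
  by rewrite !sqnorm_ge0.
rewrite (sqnormD G) dotvDr dotvZr dotvDr dotvNr.
rewrite sqnormZ sqnormB in N.
rewrite (dotvC q h) in firm; rewrite (dotvC q E) in yEq.
rewrite !invfM !invrK in yGa yGE.
move: (sqnorm (a + _)) N hq Gh HH yEq yGa yGE firm aL G0 q0 E0 a0 => N.
move: (sqnorm G) (sqnorm q) (sqnorm h) (sqnorm a) (sqnorm E) (dotv G q) (dotv h q)
  (dotv E q) (dotv G h) (dotv G E) (dotv G a) => U Q HH A EE Gq hq Eq Gh GE Ga.
move=> Nle hqE GhE HHle yEq yGa yGE firm AL U0 Q0 E0 A0.
have xi0 : 0 < xi.
  rewrite -(pmulr_lgt0 _ (_ : 0 < 2 + 2 * L ^+ 2 * lam ^+ 2)) ?xiE //.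
  by rewrite addr_gt0 // !mulr_gt0 // ?exprn_gt0.
have xi2 : xi <= 1 / 2.
  have : 0 <= xi * (L ^+ 2 * lam ^+ 2) by rewrite !mulr_ge0 ?exprn_ge0 // ltW.
  lra.
(* By [xiE], [xi + xi * L ^+ 2 * lam ^+ 2 = 1 / 2], and the left side is at least
   [2 * xi * L * lam]. *)
have xiL : xi * L * lam <= 1 / 4.
  have : 0 <= xi * (1 - L * lam) ^+ 2 by rewrite mulr_ge0 ?sqr_ge0 // ltW.
  lra.
move: c2 yGa yGE Nle; have lK : lam * lam^-1 = 1 by rewrite divff ?gt_eqF.
have tK : tau * tau^-1 = 1 by rewrite divff ?gt_eqF.
have l'0 : 0 < lam^-1 by rewrite invr_gt0.
have t'0 : 0 < tau^-1 by rewrite invr_gt0.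
move: (lam^-1) (tau^-1) lK tK l'0 t'0 => l t lK tK l0 t0 c2 yGa yGE Nle.
(* From here [l] and [t] are [lam^-1] and [tau^-1]. Smallness of [tau] makes [l] and [L] negligible
   against [t]. *)
have s1 : l <= t / 2000.
  have : l * t * (1000 * tau) <= l * t * (xi * lam) by rewrite ler_pM2l ?mulr_gt0.
  have -> : l * t * (1000 * tau) = 1000 * l * (tau * t) by ring.
  have -> : l * t * (xi * lam) = xi * t * (lam * l) by ring.
  rewrite tK lK; have : xi * t <= 1 / 2 * t by rewrite ler_pM2r.
  lra.
have s2 : L <= t / 4000.
  have : L * t * (1000 * tau) <= L * t * (xi * lam) by rewrite ler_pM2l ?mulr_gt0.
  have -> : L * t * (1000 * tau) = 1000 * L * (tau * t) by ring.
  have -> : L * t * (xi * lam) = xi * L * lam * t by ring.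
  rewrite tK; have : xi * L * lam * t <= 1 / 4 * t by rewrite ler_pM2r.
  lra.
(* Pairing [h = - tau G + E] with [q] trades [<G, q>] for [<h, q>]; firm nonexpansiveness then
   yields in [b1] the dominant negative multiple of [t * Q]. *)
have GqE : Gq = t * Eq - t * hq.
  rewrite hqE; have -> : t * Eq - t * (- tau * Gq + Eq) = (tau * t) * Gq by ring.
  by rewrite tK mul1r.
have b1 : ((1 - xi) * t - l) * Q <= ((1 - xi) * t - l) * hq.
  rewrite ler_wpM2l //; have : xi * t <= 1 / 2 * t by rewrite ler_pM2r.
  lra.
have b2 : (1 - xi) * t * Eq <= t * (45 / 100 * Q + 10 / 18 * EE).
  have h1 : Eq <= 45 / 100 * Q + 10 / 18 * EE by clear - yEq; lra.
  have h0 : 0 <= 45 / 100 * Q + 10 / 18 * EE by clear - Q0 E0; lra.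
  have -> : (1 - xi) * t * Eq = t * ((1 - xi) * Eq) by ring.
  rewrite ler_pM2l //; apply: le_trans (_ : (1 - xi) * (45 / 100 * Q + 10 / 18 * EE) <= _).
    by rewrite ler_wpM2l //; clear - xi2; lra.
  by rewrite ler_piMl //; clear - xi0; lra.
have b3 : xi * lam * Ga <= xi * tau * U / 2 + (1 / 2 - xi) / 2 * (t * Q).
  have : xi * lam * (2 * Ga) <= xi * lam * (tau * l * U + t * lam * A).
    by rewrite ler_pM2l ?mulr_gt0.
  have -> : xi * lam * (tau * l * U + t * lam * A) =
    xi * tau * (lam * l) * U + xi * lam ^+ 2 * t * A by ring.
  have : xi * lam ^+ 2 * t * A <= xi * lam ^+ 2 * t * (L ^+ 2 * Q).
    by rewrite ler_pM2l ?mulr_gt0 ?exprn_gt0.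
  have -> : xi * lam ^+ 2 * t * (L ^+ 2 * Q) =
    (xi * (2 + 2 * L ^+ 2 * lam ^+ 2) / 2 - xi) * (t * Q) by field.
  rewrite xiE lK; lra.
have b4 : xi * lam / 2 * N <= l * Q / 2 + 2 * xi * l * (tau ^+ 2 * U + EE).
  have : xi * lam * N <= xi * lam * (2 * A + 2 * (l ^+ 2 * (HH - Q))).
    rewrite ler_pM2l ?mulr_gt0 //; apply: le_trans Nle _.
    have : l ^+ 2 * (HH - 2 * hq + Q) <= l ^+ 2 * (HH - Q).
      by rewrite ler_pM2l ?exprn_gt0 //; clear - firm; lra.
    lra.
  have -> : xi * lam * (2 * A + 2 * (l ^+ 2 * (HH - Q))) =
    2 * (xi * lam * A) + 2 * (xi * (lam * l) * l * (HH - Q)) by ring.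
  have : xi * lam * A <= xi * lam * (L ^+ 2 * Q) by rewrite ler_pM2l ?mulr_gt0.
  have -> : xi * lam * (L ^+ 2 * Q) = (xi * lam ^+ 2 * L ^+ 2) * (l * Q).
    by rewrite -[LHS]mulr1 -lK; ring.
  have : (xi * lam ^+ 2 * L ^+ 2) * (l * Q) <= 1 / 2 * (l * Q).
    by rewrite ler_wpM2r ?mulr_ge0 ?(ltW l0) //; clear - xiE xi0; lra.
  have : xi * l * (HH - Q) <= xi * l * (2 * (tau ^+ 2 * U) + 2 * EE).
    by rewrite ler_pM2l ?mulr_gt0 //; clear - HHle firm Q0; lra.
  rewrite lK; lra.
have tE0 : 0 <= t * EE by rewrite mulr_ge0 // ltW.
have b5 : xi * GE <= 19 / 200 * (xi * tau * U) + 4 / 3 * (t * EE).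
  have : xi * (2 * GE) <= xi * (19 / 100 * tau * U) + 100 / 19 * (xi * (t * EE)).
    have -> : xi * (19 / 100 * tau * U) + 100 / 19 * (xi * (t * EE)) =
      xi * (19 / 100 * tau * U + 100 / 19 * (t * EE)) by ring.
    rewrite ler_pM2l //; apply: le_trans yGE _; lra.
  have : xi * (t * EE) <= 1 / 2 * (t * EE) by rewrite ler_wpM2r // mulr_ge0 // ltW.
  lra.
have u1 : xi * l * (tau ^+ 2 * U) <= 1 / 2000 * (xi * tau * U).
  have -> : xi * l * (tau ^+ 2 * U) = l * tau * (xi * tau * U) by ring.
  have := ler_wpM2r (ltW tau0) s1; rewrite -[t / 2000 * tau]mulrAC (mulrC t) tK => lt.
  by rewrite ler_wpM2r // !mulr_ge0 ?(ltW tau0) ?(ltW xi0).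
have u2 : xi * l * EE <= 1 / 1000 * (t * EE).
  have hx : xi * l * EE <= 1 / 2 * l * EE
    by rewrite -(mulrA xi) -(mulrA (1 / 2)) ler_wpM2r ?mulr_ge0 ?(ltW l0).
  have := ler_wpM2r E0 s1; clear - hx tE0; lra.
have u3 := ler_wpM2r Q0 s1; have u4 := ler_wpM2r Q0 s2.
have tQ0 : 0 <= t * Q by rewrite mulr_ge0 // ltW.
have xQ : xi * (t * Q) <= 1 / 2 * (t * Q) by rewrite ler_wpM2r.
have xU0 : 0 <= xi * tau * U by rewrite !mulr_ge0 ?(ltW xi0) ?(ltW tau0).
have e1 : xi * lam * (l * (Gh - Gq)) = xi * (Gh - Gq).
  by rewrite -mulrA (mulrA lam) lK mul1r.
have e3 : xi * Gh = xi * GE - xi * tau * U by rewrite GhE; ring.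
have e2 : (1 - xi) * Gq = (1 - xi) * t * Eq - (1 - xi) * t * hq by rewrite GqE; ring.
(* The budget: the term [- xi * tau * U] of [e3] loses [1/2] ([b3]), [19/200] ([b5]) and [1/1000]
   ([b4], [u1]), so at least [2/5] of it is left; [t * EE] collects [10/18 + 4/3 + 1/500 < 2]; the
   total coefficient of [t * Q] is negative because [xi <= 1/2]. *)
clear - b1 b2 b3 b4 b5 u1 u2 u3 u4 tQ0 tE0 xQ xU0 e1 e2 e3; lra.
Qed.

End MeritDescent.

(** * The normal map, the merit function and its decrease over a window *)

Section NormalMap.
Variables (R : realType) (d : nat) (phi : 'rV[R]_d -> \bar R) (f : 'rV[R]_d -> R).
Variables (lam L psibar : R).
Hypotheses (cphi : convex_fun phi) (lphi : lsc_fun phi) (pphi : proper_fun phi).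
Hypotheses (C1f : C1 f) (lam0 : 0 < lam) (L0 : 0 < L).
Hypothesis fL : lipschitz_vf (grad f) L.
Hypothesis psi_ge : forall y, domf phi y -> (psibar%:E <= (f y)%:E + phi y)%E.
Implicit Types (x y z : 'rV[R]_d) (xi tau : R).

(** (A.1) bounds [phi] below by [psibar - f], and the descent lemma bounds [f] above on a unit ball.
    This discharges the hypothesis [bphi] on the proximal operator. *)
Lemma phi_locally_lbounded x0 :
  exists B : R, forall y, sqnorm (y - x0) <= 1 -> (B%:E <= phi y)%E.
Proof.
exists (psibar - (f x0 + (sqnorm (grad f x0) + 1) / 2 + L / 2)) => y y1.
have [->|yoo] := eqVneq (phi y) +oo%E; first exact: leey.
have yfin : (phi y < +oo)%E by rewrite lt_neqAle yoo leey.
have [b yb] := phi_fin pphi yfin.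
have := psi_ge yfin; rewrite yb -EFinD !lee_fin.
have := descent_lemma C1f.1 L0 fL x0 y.
have := young_dotv (grad f x0) (y - x0) ltr01; rewrite invr1 !mul1r.
have : L / 2 * sqnorm (y - x0) <= L / 2 by rewrite ler_piMr // divr_ge0 // ltW.
lra.
Qed.
Let bphi := phi_locally_lbounded.

Let px := prox lam phi.
Let G := Fnor f lam phi.

(** Real-valued form of [Hxi]; [fine] loses nothing because [phi] is finite at proximal points. *)
Definition merit xi z :=
  f (px z) + fine (phi (px z)) + xi * lam / 2 * sqnorm (G z).

Lemma HxiE xi z : Hxi f phi lam xi z = (merit xi z)%:E.
Proof.
have [a pa] := phi_prox_fin lam0 cphi lphi pphi bphi z.
by rewrite /Hxi /merit /px /G pa !EFinD.
Qed.

Lemma merit_ge xi z : psibar + xi * lam / 2 * sqnorm (G z) <= merit xi z.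
Proof.
have [a pa] := phi_prox_fin lam0 cphi lphi pphi bphi z.
have := @psi_ge (px z); rewrite /domf /= /merit /px pa ltry -EFinD lee_fin.
by move=> /(_ isT) h; rewrite lerD2r.
Qed.

(** [Fnat] at [px z] is a difference of two proximal points, whose arguments differ by exactly
    [lam *: G z]. *)
Lemma FnatE_le z : sqnorm (Fnat f lam phi (px z)) <= lam ^+ 2 * sqnorm (G z).
Proof.
rewrite -sqnormZ /Fnat.
have -> : lam *: G z = z - (px z - lam *: grad f (px z)).
  rewrite /G /Fnor -/px scalerDr scalerA divff ?gt_eqF // scale1r.
  by rewrite opprB addrCA addrA.
exact: prox_nonexpansive.
Qed.

(** Both [prox] and [id - prox] are nonexpansive. The constant equals [1 / (xi * lam ^+ 2)] for the
    [xi] of the merit function, which ties it to the step-size restriction. *)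
Lemma Fnor_lipschitz z z' :
  sqnorm (G z - G z') <= (2 * L ^+ 2 + 2 * lam ^- 2) * sqnorm (z - z').
Proof.
have := prox_firmly_nonexpansive lam0 cphi lphi pphi bphi z z'; rewrite -/px => firm.
have := lipschitz_sqnorm L0 fL (px z) (px z').
have -> : G z - G z' = (grad f (px z) - grad f (px z'))
    + lam^-1 *: ((z - z') - (px z - px z')).
  rewrite /G /Fnor -/px; move: (px z) (px z') (grad f _) (grad f _) => a b p p'.
  by apply/rowP => k; rewrite !mxE; ring.
move: (grad f _ - _) => a aL; have := sqnormD_le2 a (lam^-1 *: ((z - z') - (px z - px z'))).
rewrite sqnormZ exprVn.
have : 0 < lam ^- 2 by rewrite invr_gt0 exprn_gt0.
move: (z - z') (px z - px z') (lam ^- 2) firm aL => h q l firm aL l0.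
have : 0 <= L ^+ 2 by rewrite exprn_ge0 // ltW.
move: (L ^+ 2) aL => LL aL LL0.
rewrite (sqnormB h) (dotvC h).
have : 0 <= sqnorm h - 2 * dotv q h + sqnorm q by rewrite (dotvC q) -sqnormB sqnorm_ge0.
have := sqnorm_ge0 q.
move: (sqnorm q) (sqnorm h) (sqnorm a) (dotv q h) firm aL => Q H A qh firm aL q0 hq.
have s1 : LL * Q <= LL * H by rewrite ler_wpM2l //; lra.
have s2 : l * (H - 2 * qh + Q) <= l * H by rewrite ler_pM2l //; lra.
move=> h2; apply: le_trans h2 _; lra.
Qed.

(** The [phi] part uses the subgradient at the new point [px z'], which contributes the term
    [- lam^-1 |q|^2] with [q = px z' - px z]; adding the descent lemma for [f] recombines the
    gradient and proximal parts into [<G z, q>]. *)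
Lemma merit_step xi tau z z' E :
  xi * (2 + 2 * L ^+ 2 * lam ^+ 2) = 1 -> 0 < tau -> 1000 * tau <= xi * lam ->
  z' - z = - tau *: G z + E ->
  merit xi z' <=
    merit xi z - 2 / 5 * (xi * tau * sqnorm (G z)) + 2 * (tau^-1 * sqnorm E).
Proof.
move=> xiE tau0 tl hE.
have [a pa] := phi_prox_fin lam0 cphi lphi pphi bphi z.
have [b pb] := phi_prox_fin lam0 cphi lphi pphi bphi z'.
have := prox_subgradient lam0 cphi lphi pphi bphi pb pa.
have := prox_firmly_nonexpansive lam0 cphi lphi pphi bphi z' z; rewrite -/px => firm.
have := lipschitz_sqnorm L0 fL (px z') (px z) => aL.
have := descent_lemma C1f.1 L0 fL (px z) (px z').
have := merit_increment_le lam0 L0 tau0 xiE tl hE firm aL.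
have GE : G z' = G z + (grad f (px z') - grad f (px z)
    + lam^-1 *: ((z' - z) - (px z' - px z))).
  rewrite /G /Fnor -/px; move: (px z) (px z') (grad f _) (grad f _) => u v p p'.
  by apply/rowP => k; rewrite !mxE; ring.
rewrite /merit -GE -/px pa pb /= => H1 H2 H3.
have e1 : dotv (G z) (px z' - px z) = dotv (grad f (px z)) (px z' - px z)
    + lam^-1 * dotv (z - px z) (px z' - px z) by rewrite /G /Fnor dotvDl dotvZl.
have e2 : dotv (z' - px z') (px z - px z') =
    - (dotv (z' - z) (px z' - px z) + dotv (z - px z) (px z' - px z)
       - sqnorm (px z' - px z)).
  by rewrite /sqnorm !dotvE; ring.
rewrite e2 in H3; rewrite e1 in H1; move: H1 H2 H3.
move: (dotv (grad f (px z)) _) (dotv (z' - z) _) (dotv (z - px z) _).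
move: (sqnorm (px z' - px z)) (sqnorm (G z')) (sqnorm (G z)) (sqnorm E).
move: (f (px z')) (f (px z)) => {e1 e2 GE aL firm hE} *; lra.
Qed.

Section Window.
Variables (xi : R) (al : nat -> R) (z e : nat -> 'rV[R]_d).
Hypothesis xiE : xi * (2 + 2 * L ^+ 2 * lam ^+ 2) = 1.
Hypothesis al0 : forall k, 0 < al k.
Hypothesis zS : forall k, z k.+1 = z k - al k *: (G (z k) + e k).

Definition noise m i := \sum_(m <= j < i) al j *: e j.
(** The first term averages the noise of the prefixes of the window, which makes the iterates drift
    and so [G] vary; the 4 is the factor 2 of [merit_step] times the 2 from splitting its error
    vector. *)
Definition window_noise m n :=
  (\sum_(m <= i < n) al i)^-1 * (\sum_(m <= i < n) al i * sqnorm (noise m i))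
  + 4 * sqnorm (noise m n).

Lemma iterate_increment m i : (m <= i)%N ->
  z i - z m = - (\sum_(m <= j < i) al j) *: G (z m)
    + - ((\sum_(m <= j < i) al j *: (G (z j) - G (z m))) + noise m i).
Proof.
elim: i => [|i IH]; first by rewrite leqn0 => /eqP ->; rewrite /noise !big_geq // subrr oppr0 scale0r !addr0 oppr0 addr0.
rewrite leq_eqVlt => /predU1P[->|mi].
  by rewrite /noise !big_geq // subrr oppr0 scale0r !addr0 oppr0 addr0.
rewrite /noise !big_nat_recr //= zS addrAC (IH mi) -/(noise m i).
move: (\sum_(m <= j < i) al j) (\sum_(m <= j < i) _) (noise m i) => s A B.
by move: (G _) (G _) => g g'; apply/rowP => k; rewrite !mxE; ring.
Qed.

(** The window is treated as one step of size [tau]. The variation [A] of [G] controls the drift of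
    the iterates and is controlled by it, so it is bounded in terms of itself and absorbed. *)
Lemma window_descent m n : (m < n)%N ->
  1000 * (\sum_(m <= i < n) al i) <= xi * lam ->
  merit xi (z n) <= merit xi (z m)
    - 1 / 10 * (xi * (\sum_(m <= i < n) al i) * sqnorm (G (z m)))
    + (\sum_(m <= i < n) al i)^-1 * window_noise m n.
Proof.
move=> mn; set tau := \sum_(m <= i < n) al i => tl.
have tau0 : 0 < tau.
  by rewrite /tau big_ltn // ltr_pwDl // sumr_ge0 // => i _; exact: ltW.
pose A := \sum_(m <= i < n) al i * sqnorm (G (z i) - G (z m)).
pose NS := \sum_(m <= i < n) al i * sqnorm (noise m i).
pose U := sqnorm (G (z m)); pose K := 2 * L ^+ 2 + 2 * lam ^- 2.
have U0 : 0 <= U := sqnorm_ge0 (G (z m)).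
have A0 : 0 <= A by apply: sumr_ge0 => i _; rewrite mulr_ge0 ?sqnorm_ge0 ?(ltW (al0 i)).
have NS0 : 0 <= NS by apply: sumr_ge0 => i _; rewrite mulr_ge0 ?sqnorm_ge0 ?(ltW (al0 i)).
have K0 : 0 <= K by rewrite addr_ge0 // mulr_ge0 ?invr_ge0 ?exprn_ge0 ?(ltW L0) ?(ltW lam0).
have xi0 : 0 < xi.
  rewrite -(pmulr_lgt0 _ (_ : 0 < 2 + 2 * L ^+ 2 * lam ^+ 2)) ?xiE //.
  by rewrite addr_gt0 // !mulr_gt0 // ?exprn_gt0.
(* Because [K * (xi * lam) ^+ 2 = xi] and [1000 * tau <= xi * lam]. *)
have Kt : 1000 * (K * tau ^+ 2) <= xi.
  have : (40 * tau) ^+ 2 <= (xi * lam) ^+ 2.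
    rewrite ler_sqr ?nnegrE ?mulr_ge0 ?(ltW tau0) ?(ltW lam0) ?(ltW xi0) //; lra.
  move/(ler_wpM2l K0).
  have -> : K * (xi * lam) ^+ 2 = xi * (xi * (2 + 2 * L ^+ 2 * lam ^+ 2)).
    by rewrite /K; field; rewrite gt_eqF.
  have : 0 <= K * tau ^+ 2 by rewrite mulr_ge0 ?exprn_ge0 // ltW.
  rewrite xiE; lra.
have xi2 : xi <= 1 / 2.
  have : 0 <= xi * (L ^+ 2 * lam ^+ 2).
    by rewrite !mulr_ge0 ?exprn_ge0 ?(ltW xi0) ?(ltW L0) ?(ltW lam0).
  have := xiE.
  lra.
have part i : (m <= i <= n)%N -> 0 <= \sum_(m <= j < i) al j <= tau
    /\ \sum_(m <= j < i) al j * sqnorm (G (z j) - G (z m)) <= A.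
  move=> /andP[mi ni]; rewrite /tau /A !(big_cat_nat mi ni) /=.
  have h0 k l : 0 <= \sum_(k <= j < l) al j by apply: sumr_ge0 => j _; exact: ltW.
  rewrite h0 !lerDl h0; split => //.
  by apply: sumr_ge0 => j _; rewrite mulr_ge0 ?sqnorm_ge0 ?(ltW (al0 j)).
pose B i := \sum_(m <= j < i) al j *: (G (z j) - G (z m)).
have Ble i : (m <= i <= n)%N -> sqnorm (B i) <= tau * A.
  move=> /part[/andP[s0 s1] s2].
  apply: le_trans (sqnorm_sum_le _ _ al0) _; apply: ler_pM => //.
  by apply: sumr_ge0 => j _; rewrite mulr_ge0 ?sqnorm_ge0 ?(ltW (al0 j)).
have Dle i : (m <= i < n)%N ->
    sqnorm (z i - z m) <= 3 * (tau ^+ 2 * U) + 3 * (tau * A) + 3 * sqnorm (noise m i).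
  move=> /andP[mi ni]; have mn' : (m <= i <= n)%N by rewrite mi ltnW.
  rewrite (iterate_increment mi) -/(B i) scaleNr -opprD sqnormN addrA.
  apply: le_trans (sqnormD_le3 _ _ _) _; rewrite sqnormZ.
  have [/andP[s0 s1] _] := part i mn'; have := Ble i mn'.
  have : (\sum_(m <= j < i) al j) ^+ 2 * U <= tau ^+ 2 * U.
    by rewrite ler_wpM2r // ler_sqr // nnegrE // ltW.
  rewrite /U; lra.
have Ale : A <= K * (3 * (tau ^+ 3 * U) + 3 * (tau ^+ 2 * A) + 3 * NS).
  have -> : K * (3 * (tau ^+ 3 * U) + 3 * (tau ^+ 2 * A) + 3 * NS) =
    \sum_(m <= i < n) al i *
      (K * (3 * (tau ^+ 2 * U) + 3 * (tau * A) + 3 * sqnorm (noise m i))).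
    under eq_bigr => i _ do rewrite mulrCA mulrDr (mulrCA _ 3).
    rewrite -mulr_sumr big_split /= -mulr_suml -/tau -mulr_sumr -/NS; ring.
  rewrite {1}/A [X in X <= _]big_nat [X in _ <= X]big_nat; apply: ler_sum => i mi; rewrite ler_pM2l //.
  by apply: le_trans (Fnor_lipschitz _ _) _; rewrite ler_wpM2l //; exact: Dle.
have t3 : 0 <= tau ^+ 3 * U by rewrite mulr_ge0 ?exprn_ge0 // ltW.
(* By [Kt] the term [3 * K * tau ^+ 2 * A] is at most a small fraction of [A]; moving it to the left
   costs less than the factor 2 allowed here. *)
have A6 : A <= 6 * (K * (tau ^+ 3 * U)) + 6 * (K * NS).
  have : 1000 * (K * tau ^+ 2) * A <= xi * A by rewrite ler_wpM2r.
  have : xi * A <= 1 / 2 * A by rewrite ler_wpM2r.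
  have : 0 <= K * NS by rewrite mulr_ge0.
  have : 0 <= K * (tau ^+ 3 * U) by rewrite mulr_ge0.
  lra.
have hE : z n - z m = - tau *: G (z m) + - (B n + noise m n).
  exact: iterate_increment (ltnW mn).
have := merit_step xiE tau0 tl hE; rewrite sqnormN -/U.
have := sqnormD_le2 (B n) (noise m n).
have := Ble n; rewrite leqnn (ltnW mn) => /(_ isT).
rewrite /window_noise -/tau -/NS -/U.
have t'0 : 0 < tau^-1 by rewrite invr_gt0.
have tK : tau * tau^-1 = 1 by rewrite divff ?gt_eqF.
move: (sqnorm (B n)) (sqnorm (noise m n)) (sqnorm (_ + _)) => b s E hb hE2.
move: (merit _ _) (merit _ _) => H1 H2.
have h1 : tau^-1 * E <= 2 * A + 2 * (tau^-1 * s).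
  have : tau^-1 * E <= tau^-1 * (2 * (tau * A) + 2 * s) by rewrite ler_pM2l //; lra.
  have -> : tau^-1 * (2 * (tau * A) + 2 * s) = 2 * (tau * tau^-1) * A + 2 * (tau^-1 * s) by ring.
  by rewrite tK mulr1.
have h2 : 24 * (K * (tau ^+ 3 * U)) <= 1 / 10 * (xi * tau * U).
  have : 1000 * (K * tau ^+ 2) * (tau * U) <= xi * (tau * U).
    by rewrite ler_wpM2r // mulr_ge0 // ltW.
  have -> : 1000 * (K * tau ^+ 2) * (tau * U) = 1000 * (K * (tau ^+ 3 * U)) by ring.
  have : 0 <= xi * (tau * U) by rewrite !mulr_ge0 // ltW.
  lra.
have h3 : 24 * (K * NS) <= tau^-1 * (tau^-1 * NS).
  have : 1000 * (K * tau ^+ 2) * (tau^-1 * (tau^-1 * NS)) <= xi * (tau^-1 * (tau^-1 * NS)).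
    by rewrite ler_wpM2r // !mulr_ge0 // ltW.
  have -> : 1000 * (K * tau ^+ 2) * (tau^-1 * (tau^-1 * NS)) =
    1000 * (K * NS) * ((tau * tau^-1) * (tau * tau^-1)) by ring.
  have : xi * (tau^-1 * (tau^-1 * NS)) <= 1 / 2 * (tau^-1 * (tau^-1 * NS)).
    by rewrite ler_wpM2r // !mulr_ge0 // ltW.
  have : 0 <= K * NS by rewrite mulr_ge0.
  rewrite tK; lra.
have h4 : 0 <= xi * tau * U by rewrite !mulr_ge0 ?(ltW xi0) ?(ltW tau0).
rewrite mulrDr (mulrCA _ 4); lra.
Qed.
End Window.
End NormalMap.

(* The interval [m, k) is cut greedily into windows of accumulated step size
   just above T/5; the last window may be shorter, and there the lower bound on
   H replaces the descent inequality. *)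
Lemma window_partition (R : realType) (al : nat -> R) (T : R) (m k : nat) :
  0 < T -> (forall i, 0 < al i) -> (forall i, al i <= T / 5) -> (m <= k)%N ->
  exists s : seq (nat * nat),
    [/\ forall c : nat -> R, \sum_(p <- s) \sum_(p.1 <= i < p.2) c i = \sum_(m <= i < k) c i,
        forall p, p \in s -> (p.1 < p.2 <= k)%N &
        forall (H U : nat -> R) (W : nat -> nat -> R) (c : R),
          0 <= c -> (forall i, 0 <= U i) -> (forall i j, 0 <= W i j) ->
          (forall i, c * (T * U i) <= H i) ->
          (forall i j, (i < j)%N -> \sum_(i <= l < j) al l <= 2 * T / 5 ->
             H j <= H i - c * ((\sum_(i <= l < j) al l) * U i)
                    + (\sum_(i <= l < j) al l)^-1 * W i j) ->
          c * \sum_(p <- s) (\sum_(p.1 <= l < p.2) al l) * U p.1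
            <= H m + 5 / T * \sum_(p <- s) W p.1 p.2].
Proof.
move=> T0 al0 alT; move: {2}(k - m)%N (leqnn (k - m)) => N.
elim: N m => [|N IH] m Nk mk.
  have -> : m = k by apply/eqP; rewrite eqn_leq mk -subn_eq0 -leqn0.
  exists [::]; split => [c|p|H U W c c0 U0 W0 HU _] //; first by rewrite big_nil big_geq.
  by rewrite !big_nil !mulr0 addr0 (le_trans _ (HU k)) // !mulr_ge0 // ltW.
have [->|mk'] := eqVneq m k; first by apply: IH; rewrite // subnn.
have {mk'} mk' : (m < k)%N by rewrite ltn_neqAle mk'.
have a0 i j : 0 <= \sum_(i <= l < j) al l by apply: sumr_ge0 => l _; exact: ltW.
(* A short remainder forms a single window: its weight is at most [T], so [c * (T * U m) <= H m]
   covers it. *)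
have [small|large] := ltP (\sum_(m <= l < k) al l) (T / 5).
  exists [:: (m, k)]; split => [c|p|H U W c c0 U0 W0 HU _].
  - by rewrite big_seq1.
  - by rewrite inE => /eqP -> /=; rewrite mk' leqnn.
  rewrite !big_seq1 /= -[leLHS]addr0 lerD //; last first.
    by rewrite mulr_ge0 // divr_ge0 // ltW.
  apply: le_trans (HU m); rewrite ler_wpM2l // ler_wpM2r //.
  by rewrite (le_trans (ltW small)) // ler_pdivrMr // ler_peMr ?ltW //; lra.
have exn : exists n, (m < n)%N && (T / 5 <= \sum_(m <= l < n) al l).
  by exists k; rewrite mk'.
case: (ex_minnP exn) => n /andP[mn Tn] nmin.
have nk : (n <= k)%N by apply: nmin; rewrite mk'.
(* By minimality of [n] the sum without its last step is at most [T / 5], and so is that step. *)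
have n2 : \sum_(m <= l < n) al l <= 2 * T / 5.
  case: n mn Tn nmin nk => // n mn Tn nmin nk.
  rewrite big_nat_recr //=.
  have : \sum_(m <= l < n) al l <= T / 5.
    rewrite leNgt; apply/negP => h.
    have mn' : (m < n)%N.
      rewrite ltn_neqAle -ltnS mn andbT; apply: contraTneq h => ->.
      by rewrite big_geq // -leNgt divr_ge0 // ltW.
    by have := nmin n; rewrite mn' (ltW h) ltnn => /(_ isT).
  have := alT n; lra.
have [||s [s1 s2 s3]] := IH n; [by lia|by []|].
exists ((m, n) :: s); split => [c|p|H U W c c0 U0 W0 HU HD].
- by rewrite big_cons s1 /= -big_cat_nat // ltnW.
- by rewrite inE => /predU1P[-> /=|/s2 //]; rewrite mn.
rewrite !big_cons /= !mulrDr.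
have := s3 H U W c c0 U0 W0 HU HD; have := HD m n mn n2.
have : (\sum_(m <= l < n) al l)^-1 * W m n <= 5 / T * W m n.
  have T5 : 0 < T / 5 by rewrite divr_gt0.
  rewrite ler_wpM2r // -[5 / T]invf_div lef_pV2 // posrE //.
  exact: lt_le_trans Tn.
lra.
Qed.

(** * Lower integrals of nonnegative functions *)

Section LowerIntegral.
Context (dT : measure_display) (T : measurableType dT) (R : realType).
Variable mu : {measure set T -> \bar R}.
Local Open Scope ereal_scope.
Import HBNNSimple.

Lemma sintegral_le_integral (f : T -> \bar R) (h : {nnsfun T >-> R}) :
  (forall x, (h x)%:E <= f x) -> sintegral mu h <= \int[mu]_x f x.
Proof.
move=> hf; have f0 x : 0 <= f x by apply: le_trans (hf x); rewrite lee_fin.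
by rewrite ge0_integralTE //; apply: ereal_sup_ubound; exists h.
Qed.

Lemma integral_le_of_sintegral (f : T -> \bar R) (c : \bar R) :
  (forall x, 0 <= f x) ->
  (forall h : {nnsfun T >-> R}, (forall x, (h x)%:E <= f x) -> sintegral mu h <= c) ->
  \int[mu]_x f x <= c.
Proof.
by move=> f0 H; rewrite ge0_integralTE //; apply: ge_ereal_sup => _ [h /= hf <-]; exact: H.
Qed.

(* No measurability is assumed: on nonnegative functions the integral is the
   lower integral, which is monotone and superadditive. *)
Lemma le_lower_integral (f g : T -> \bar R) :
  (forall x, 0 <= f x) -> (forall x, f x <= g x) ->
  \int[mu]_x f x <= \int[mu]_x g x.
Proof.
move=> f0 fg; apply: integral_le_of_sintegral => // h hf.
by apply: sintegral_le_integral => x; apply: le_trans (hf x) (fg x).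
Qed.

(** Simple functions below [f] and [g] combine into one below [w f + g]; the suprema are then taken
    one after the other. *)
Lemma lower_integral_superadditive (w : R) (f g : T -> \bar R) :
  (0 <= w)%R -> (forall x, 0 <= f x) -> (forall x, 0 <= g x) ->
  w%:E * \int[mu]_x f x + \int[mu]_x g x <= \int[mu]_x (w%:E * f x + g x).
Proof.
rewrite le_eqVlt => /predU1P[<- f0 g0|w0 f0 g0].
  rewrite mul0e add0e; apply: le_lower_integral => // x.
  by rewrite mul0e add0e.
set c := \int[mu]_x (_ + _).
(* Once [c] is finite, all the quantities below it are finite as well, so they may be moved across
   extended-real inequalities. *)
have [->|c1] := eqVneq c +oo; first exact: leey.
have cty : c < +oo by rewrite lt_neqAle c1 leey.
have cfin : c \is a fin_num.
  rewrite ge0_fin_numE //; apply: integral_ge0 => x _.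
  by rewrite adde_ge0 // mule_ge0 // lee_fin ltW.
have key (h1 h2 : {nnsfun T >-> R}) : (forall x, (h1 x)%:E <= f x) ->
    (forall x, (h2 x)%:E <= g x) -> w%:E * sintegral mu h1 + sintegral mu h2 <= c.
  move=> h1f h2g.
  rewrite -sintegralrM.
  have -> : sintegral mu (cst w \* h1)%R = sintegral mu (scale_nnsfun h1 (ltW w0)) by [].
  rewrite -sintegralD //.
  apply: (@sintegral_le_integral _ (add_nnsfun (scale_nnsfun h1 (ltW w0)) h2)) => x /=.
  by rewrite EFinD EFinM leeD // lee_pmul2l.
have z0 (k : T -> \bar R) : (forall x, 0 <= k x) -> forall x, ((nnsfun0 : {nnsfun T >-> R}) x)%:E <= k x by [].
have sz : sintegral mu (nnsfun0 : {nnsfun T >-> R}) = 0 := sintegral0 mu.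
have sfin (h : {nnsfun T >-> R}) : (forall x, (h x)%:E <= g x) -> sintegral mu h \is a fin_num.
  move=> hg; rewrite ge0_fin_numE ?sintegral_ge0 //.
  have := key _ _ (z0 _ f0) hg; rewrite sz mule0 add0e => /le_lt_trans; exact.
have key2 (h : {nnsfun T >-> R}) : (forall x, (h x)%:E <= g x) ->
    w%:E * \int[mu]_x f x + sintegral mu h <= c.
  move=> hg; rewrite -leeBrDr ?sfin // -lee_pdivlMl //.
  apply: integral_le_of_sintegral => // h1 h1f.
  by rewrite lee_pdivlMl // leeBrDr ?sfin //; exact: key.
have ffin : w%:E * \int[mu]_x f x \is a fin_num.
  have wf0 : 0 <= w%:E * \int[mu]_x f x.
    by rewrite mule_ge0 ?lee_fin ?(ltW w0) ?integral_ge0.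
  rewrite ge0_fin_numE //; have := key2 _ (z0 _ g0); by rewrite sz adde0 => /le_lt_trans; exact.
rewrite addeC -leeBrDr //; apply: integral_le_of_sintegral => // h hg.
by rewrite leeBrDr // addeC; exact: key2.
Qed.

Lemma lower_integral_sum_le (I : Type) (s : seq I) (w : I -> R) (f : I -> T -> \bar R) :
  (forall i, (0 <= w i)%R) -> (forall i x, 0 <= f i x) ->
  \sum_(i <- s) (w i)%:E * \int[mu]_x f i x <=
  \int[mu]_x \sum_(i <- s) (w i)%:E * f i x.
Proof.
move=> w0 f0; elim: s => [|i s IH].
  by rewrite big_nil integral_ge0 // => x _; rewrite big_nil.
rewrite big_cons.
have -> : (fun x => \sum_(j <- i :: s) (w j)%:E * f j x) =
  (fun x => (w i)%:E * f i x + \sum_(j <- s) (w j)%:E * f j x).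
  by apply/funext => x; rewrite big_cons.
apply: le_trans (lower_integral_superadditive _ (f0 i) _) => //; first exact: leeD2l.
by move=> x; apply: sume_ge0 => j _; rewrite mule_ge0 // lee_fin.
Qed.
End LowerIntegral.

(** * Orthogonality to functions with vanishing conditional expectation *)

Section Orthogonality.
Context (dT : measure_display) (T : measurableType dT) (R : realType).
Variable P : probability T R.
Implicit Types (X Y e : T -> R) (G : set (set T)).
Import HBNNSimple.

Lemma measurable_wrt_measurable G X :
  G `<=` measurable -> measurable_wrt G X -> measurable_fun setT X.
Proof. by move=> GM GX _ B mB; rewrite setTI; apply: GM; exact: GX. Qed.

Lemma integrable_mul_sqr X Y : measurable_fun setT X -> measurable_fun setT Y ->
  P.-integrable setT (fun w => (X w ^+ 2)%:E) ->
  P.-integrable setT (fun w => (Y w ^+ 2)%:E) ->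
  P.-integrable setT (fun w => (X w * Y w)%:E).
Proof.
move=> mX mY iX iY; apply: le_integrable (integrableD measurableT iX iY) => //.
  by apply/measurable_EFinP; exact: measurable_funM.
move=> w _; rewrite /= lee_fin normrM [leRHS]ger0_norm ?addr_ge0 ?sqr_ge0 //.
rewrite -(real_normK (num_real (X w))) -(real_normK (num_real (Y w))).
have := sqr_ge0 (`|X w| - `|Y w|); have := sqr_ge0 (`|X w| + `|Y w|); lra.
Qed.

(** For a simple [X] measurable for [G] the integral is a combination of integrals of [e] over sets
    of [G]. Increasing simple approximations, dominated by [|X e|], give the general case. *)
Lemma integral_mul_ge0_eq0 G X e :
  sigma_algebra setT G -> G `<=` measurable -> measurable_wrt G X ->
  (forall w, 0 <= X w) -> P.-integrable setT (EFin \o e) ->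
  P.-integrable setT (fun w => (X w * e w)%:E) ->
  (forall A, G A -> (\int[P]_(w in A) (e w)%:E = 0)%E) ->
  (\int[P]_w (X w * e w)%:E = 0)%E.
Proof.
move=> sG GM GX X0 ie iXe e0.
(* Approximating on the space carrying the sigma-algebra [G] itself places the level sets of the
   simple functions in [G]. *)
pose T' := g_sigma_algebraType G.
have GE (A : set T) : <<s G>> A -> G A by rewrite sigma_algebra_id.
have mX : measurable_fun [set: T'] (EFin \o (X : T' -> R)).
  apply/measurable_EFinP => _ B mB; rewrite setTI.
  by apply: sub_sigma_algebra; exact: GX.
have [h [h_nd h_cvg]] := approximation measurableT mX (fun w _ => X0 w).
have hX n w : h n w <= X w.
  have cX : (fun n => h n w) @ \oo --> X w.
    exact: (fine_cvg (h_cvg w Logic.I)).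
  rewrite -(cvg_lim _ cX) //; apply: nondecreasing_cvgn_le; last by apply/cvg_ex; exists (X w).
  by move=> i j ij; have /lefP := h_nd i j ij; exact.
have hint n : P.-integrable setT (fun w => (h n w * e w)%:E) /\
    (\int[P]_w (h n w * e w)%:E = 0)%E.
  pose A y := h n @^-1` [set y]; pose s := finmap.enum_fset (fset_set (range (h n))).
  have hE w : (h n w * e w)%:E = (\sum_(y <- s) y%:E * (((EFin \o e) \_ (A y)) w))%E.
    rewrite (fimfunE (h n)) fsbig_finite //= mulr_suml -sumEFin; apply: eq_bigr => y _.
    by rewrite epatch_indic /= -!EFinM mulrA [_ * e w]mulrAC.
  have GA y : G (A y) by apply: GE; exact: (measurable_funPTI (h n)).
  have IA y : P.-integrable setT ((EFin \o e) \_ (A y)).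
    have mA := GM _ (GA y).
    by apply/(integrable_mkcond _ mA); apply: integrableS ie.
  have -> : (fun w => (h n w * e w)%:E) =
      (fun w => \sum_(y <- s) y%:E * (((EFin \o e) \_ (A y)) w))%E by apply/funext.
  split; first by apply: integrable_sum => // y _; exact: integrableZl.
  rewrite integral_sum // => [|y]; last exact: integrableZl.
  by rewrite big1 // => y _; rewrite integralZl // -integral_mkcond e0 // mule0.
have := @dominated_convergence _ T R P setT measurableT
  (fun n w => (h n w * e w)%:E) (fun w => (X w * e w)%:E) (fun w => `|(X w * e w)%:E|%E).
case.
- by move=> n; exact: measurable_int (hint n).1.
- exact: measurable_int iXe.
- apply: aeW => w _; under eq_fun do rewrite EFinM.
  rewrite EFinM; apply: cvgeZr => //; exact: h_cvg.
- exact: integrable_abse.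
- apply: aeW => w n _; rewrite !abse_EFin lee_fin !normrM ler_wpM2r //.
  by rewrite !ger0_norm.
move=> _ _; under eq_fun do rewrite (hint _).2.
by move/cvg_lim => <- //; rewrite lim_cst.
Qed.

Lemma measurable_wrtE G X : sigma_algebra setT G ->
  measurable_wrt G X <-> measurable_fun [set: g_sigma_algebraType G] X.
Proof.
move=> sG; split=> [GX _ B mB|mX B mB].
  by rewrite setTI; apply: sub_sigma_algebra; exact: GX.
have := mX measurableT B mB; rewrite setTI.
by rewrite (measurable_g_measurableTypeE sG).
Qed.

Lemma square_integrable_integrable X : measurable_fun setT X ->
  P.-integrable setT (fun w => (X w ^+ 2)%:E) -> P.-integrable setT (EFin \o X).
Proof.
move=> mX iX; have -> : EFin \o X = (fun w => (X w * 1)%:E).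
  by apply/funext => w; rewrite /= mulr1.
apply: (integrable_mul_sqr (Y := cst 1)) => //.
have -> : (fun w => (cst 1 w ^+ 2)%:E) = (cst 1%:E : T -> \bar R).
  by apply/funext => w; rewrite /= expr1n.
exact: finite_measure_integrable_cst.
Qed.

(** Split [X] into positive and negative parts; their squares are below [X ^+ 2], which keeps the
    products with [e] integrable. *)
Lemma integral_mul_eq0 G X e :
  sigma_algebra setT G -> G `<=` measurable -> measurable_wrt G X ->
  measurable_fun setT e ->
  P.-integrable setT (fun w => (X w ^+ 2)%:E) ->
  P.-integrable setT (fun w => (e w ^+ 2)%:E) ->
  (forall A, G A -> (\int[P]_(w in A) (e w)%:E = 0)%E) ->
  (\int[P]_w (X w * e w)%:E = 0)%E.
Proof.
move=> sG GM GX me iX2 ie2 e0.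
have ie := square_integrable_integrable me ie2.
have half (Y : T -> R) : measurable_wrt G Y -> (forall w, 0 <= Y w) ->
    (forall w, Y w ^+ 2 <= X w ^+ 2) ->
    P.-integrable setT (fun w => (Y w * e w)%:E) /\ (\int[P]_w (Y w * e w)%:E = 0)%E.
  move=> GY Y0 YX; have mY := measurable_wrt_measurable GM GY.
  have iY2 : P.-integrable setT (fun w => (Y w ^+ 2)%:E).
    apply: le_integrable iX2 => // [|w _]; last by rewrite !abse_EFin lee_fin !ger0_norm ?sqr_ge0.
    by apply/measurable_EFinP; exact: measurable_funX.
  have iYe := integrable_mul_sqr mY me iY2 ie2.
  by split => //; exact: (integral_mul_ge0_eq0 sG).
have GX' : measurable_fun [set: g_sigma_algebraType G] X by apply/measurable_wrtE.
have [||w|ip p0] := half (fun w => Num.max (X w) 0).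
- by apply/measurable_wrtE => //; exact: measurable_maxr.
- by move=> w; rewrite le_max lexx orbT.
- by rewrite /Num.max; case: ifP => // _; rewrite expr0n sqr_ge0.
have [||w|iq q0] := half (fun w => Num.max (- X w) 0).
- by apply/measurable_wrtE => //; apply: measurable_maxr => //; exact: measurableT_comp.
- by move=> w; rewrite le_max lexx orbT.
- by rewrite /Num.max; case: ifP => // _; rewrite ?sqrrN // expr0n sqr_ge0.
have -> : (fun w => (X w * e w)%:E) =
    (fun w => (Num.max (X w) 0 * e w)%:E - (Num.max (- X w) 0 * e w)%:E)%E.
  apply/funext => w; rewrite -EFinB -mulrBl; congr (_ * _)%:E.
  have [h|h] := leP (X w) 0; first by rewrite max_l ?oppr_ge0 // sub0r opprK.
  by rewrite max_r ?subr0 // oppr_le0 ltW.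
by rewrite integralB // p0 q0 sube0.
Qed.

End Orthogonality.

(** * Variance of scalar martingale sums *)

Section MartingaleNoise.
Context (dT : measure_display) (T : measurableType dT) (R : realType).
Variables (P : probability T R) (F : nat -> set (set T)).
Variables (al : nat -> R) (e : nat -> T -> R).
Hypothesis filF : filtration F.
Hypothesis Fe : forall j, measurable_wrt (F j.+1) (e j).
Hypothesis ie2 : forall j, P.-integrable setT (fun w => (e j w ^+ 2)%:E).
Hypothesis e0 : forall j A, F j A -> (\int[P]_(w in A) (e j w)%:E = 0)%E.

Let s m n w := \sum_(m <= j < n) al j * e j w.

Let filM j (X : T -> R) : measurable_wrt (F j) X -> measurable_fun setT X.
Proof. by have [_ FM _] := filF j; exact: measurable_wrt_measurable. Qed.

Lemma martingale_sum_measurable m n : measurable_wrt (F n) (s m n).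
Proof.
elim: n => [|n IH].
  have [sF _ _] := filF 0; apply/(measurable_wrtE _ sF).
  have -> : s m 0 = cst 0 by apply/funext => w; rewrite /s big_geq.
  exact: measurable_cst.
have [sF _ Fn] := filF n; have [sF' _ _] := filF n.+1.
apply/(measurable_wrtE _ sF'); have [mn|nm] := leqP m n; last first.
  have -> : s m n.+1 = cst 0 by apply/funext => w; rewrite /s big_geq.
  exact: measurable_cst.
have -> : s m n.+1 = (fun w => s m n w + al n * e n w).
  by apply/funext => w; rewrite /s big_nat_recr.
apply: measurable_funD; first by apply/(measurable_wrtE _ sF') => B mB; apply: Fn; exact: IH.
by apply: measurable_funM => //; apply/(measurable_wrtE _ sF').
Qed.

(** When a term is appended, the cross term integrates to 0 because the partial sum [s m n] is
    measurable for [F n]. *)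
Lemma martingale_sum_variance m n :
  P.-integrable setT (fun w => (s m n w ^+ 2)%:E) /\
  (\int[P]_w (s m n w ^+ 2)%:E =
   \sum_(m <= j < n) (al j ^+ 2)%:E * \int[P]_w (e j w ^+ 2)%:E)%E.
Proof.
have triv k : (k <= m)%N -> P.-integrable setT (fun w => (s m k w ^+ 2)%:E) /\
  (\int[P]_w (s m k w ^+ 2)%:E =
   \sum_(m <= j < k) (al j ^+ 2)%:E * \int[P]_w (e j w ^+ 2)%:E)%E.
  move=> km; have -> : (fun w => (s m k w ^+ 2)%:E) = cst 0%E.
    by apply/funext => w; rewrite /s big_geq // expr0n.
  by split; [exact: integrable0|rewrite integral0 big_geq].
elim: n => [|n [IH1 IH2]]; first exact: triv.
have [mn|nm] := leqP m n; last exact: triv.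
have [sF FM _] := filF n.
have ms := filM (martingale_sum_measurable m n); have me := filM (Fe n).
have ise := integrable_mul_sqr ms me IH1 (ie2 n).
have se0 := integral_mul_eq0 sF FM (martingale_sum_measurable m n) me IH1 (ie2 n) (@e0 n).
have -> : (fun w => (s m n.+1 w ^+ 2)%:E) = (fun w => (s m n w ^+ 2)%:E +
    ((2 * al n)%:E * (s m n w * e n w)%:E + (al n ^+ 2)%:E * (e n w ^+ 2)%:E))%E.
  apply/funext => w; rewrite /s big_nat_recr //= -!EFinM -!EFinD; congr _%:E; ring.
have i1 := integrableZl measurableT (2 * al n) ise.
have i2 := integrableZl measurableT (al n ^+ 2) (ie2 n).
have i12 := integrableD measurableT i1 i2.
split; first exact: integrableD.
by rewrite integralD // integralD // !integralZl // se0 mule0 add0e IH2 big_nat_recr.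
Qed.

End MartingaleNoise.

(** * Expected noise of a window *)

Section VectorNoise.
Context (dT : measure_display) (T : measurableType dT) (R : realType) (d : nat).
Variables (P : probability T R) (F : nat -> set (set T)).
Variables (al sg : nat -> R) (e : nat -> T -> 'rV[R]_d).
Hypothesis filF : filtration F.
Hypothesis al0 : forall j, 0 < al j.
Hypothesis Fe : forall j, rvec_measurable_wrt (F j.+1) (e j).
Hypothesis e0 : forall j i A, F j A -> (\int[P]_(w in A) (e j w ord0 i)%:E = 0)%E.
Hypothesis e2 : forall j, (\int[P]_w (sqnorm (e j w))%:E <= (sg j ^+ 2)%:E)%E.

Let me j i : measurable_fun setT (fun w => e j w ord0 i).
Proof. by have [_ FM _] := filF j.+1; exact: measurable_wrt_measurable (Fe j i). Qed.

Lemma sqnorm_sumE (v : 'rV[R]_d) : sqnorm v = \sum_i v ord0 i ^+ 2.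
Proof. by apply: eq_bigr => i _; rewrite expr2. Qed.

Let mse j : measurable_fun setT (fun w => (sqnorm (e j w))%:E).
Proof.
apply/measurable_EFinP.
have -> : (fun w => sqnorm (e j w)) = (fun w => \sum_i e j w ord0 i ^+ 2).
  by apply/funext => w; rewrite sqnorm_sumE.
by apply: measurable_sum => i; exact: measurable_funX.
Qed.

Let ie2 i j : P.-integrable setT (fun w => (e j w ord0 i ^+ 2)%:E).
Proof.
apply: (@le_integrable _ _ _ _ _ measurableT _ (fun w => (sqnorm (e j w))%:E)).
- by apply/measurable_EFinP; exact: measurable_funX.
- by move=> w _; rewrite !abse_EFin lee_fin !ger0_norm ?sqr_ge0 ?sqnorm_ge0 ?sqr_coord_le.
apply/integrableP; split => //; apply: le_lt_trans (ltry (sg j ^+ 2)).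
by apply: le_trans (e2 j); under eq_integral do rewrite abse_EFin ger0_norm ?sqnorm_ge0 //.
Qed.

Lemma noise_variance m n :
  P.-integrable setT (fun w => (sqnorm (noise al (e^~ w) m n))%:E) /\
  (\int[P]_w (sqnorm (noise al (e^~ w) m n))%:E
     <= (\sum_(m <= j < n) al j ^+ 2 * sg j ^+ 2)%:E)%E.
Proof.
have var i := martingale_sum_variance al filF (fun j => Fe j i) (ie2 i)
  (fun j => @e0 j i) m n.
have -> : (fun w => (sqnorm (noise al (e^~ w) m n))%:E) =
    (fun w => \sum_i ((\sum_(m <= j < n) al j * e j w ord0 i) ^+ 2)%:E)%E.
  apply/funext => w; rewrite sqnorm_sumE sumEFin; congr _%:E.
  by apply: eq_bigr => i _; rewrite /noise summxE; congr (_ ^+ 2); apply: eq_bigr => j _; rewrite mxE.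
split; first by apply: integrable_sum => // i _; exact: (var i).1.
rewrite integral_sum // => [|i]; last exact: (var i).1.
under eq_bigr => i _ do rewrite (var i).2.
rewrite exchange_big /= -sumEFin; apply: lee_sum => j _.
rewrite -ge0_sume_distrr; last first.
  by move=> i _; apply: integral_ge0 => w _; rewrite lee_fin sqr_ge0.
rewrite (EFinM (al j ^+ 2)) lee_pmul2l ?lte_fin ?exprn_gt0 //; apply: le_trans (e2 j).
rewrite -ge0_integral_sum //.
- apply: le_lower_integral => w.
    by apply: sume_ge0 => i _; rewrite lee_fin sqr_ge0.
  by rewrite sqnorm_sumE sumEFin.
- by move=> i; apply: measurable_int (ie2 i j).
- by move=> i w _; rewrite lee_fin sqr_ge0.
Qed.

(** The 5 is 1 for the weighted average of prefix variances, each at most that of the whole window,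
    plus the 4 of [window_noise]. *)
Lemma window_noise_expectation m n :
  P.-integrable setT (fun w => (window_noise al (e^~ w) m n)%:E) /\
  (\int[P]_w (window_noise al (e^~ w) m n)%:E
     <= (5 * \sum_(m <= j < n) al j ^+ 2 * sg j ^+ 2)%:E)%E.
Proof.
(* On an empty window the inverse of the zero step sum is 0 by convention, and the noise
   vanishes. *)
have [nm|mn] := leqP n m.
  have -> : (fun w => (window_noise al (e^~ w) m n)%:E) = cst 0%E.
    apply/funext => w.
    by rewrite /window_noise /noise !big_geq // sqnorm0 invr0 mul0r mulr0 addr0.
  by split; [exact: integrable0|rewrite integral0 big_geq // mulr0].
set V := \sum_(m <= j < n) _; set tau := \sum_(m <= i < n) al i.
have tau0 : 0 < tau.
  by rewrite /tau big_ltn // ltr_pwDl // sumr_ge0 // => i _; exact: ltW.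
pose N i w := (sqnorm (noise al (e^~ w) m i))%:E.
have iN i : P.-integrable setT (N i) := (noise_variance m i).1.
have -> : (fun w => (window_noise al (e^~ w) m n)%:E) = (fun w =>
    tau^-1%:E * (\sum_(i <- index_iota m n) (al i)%:E * N i w) + 4%:E * N n w)%E.
  by apply/funext => w; rewrite /window_noise EFinD !EFinM -sumEFin.
have i1 i := integrableZl measurableT (al i) (iN i).
have i2 := integrable_sum measurableT (index_iota m n) (fun i (_ : true) => i1 i).
have i3 := integrableZl measurableT tau^-1 i2.
have i4 := integrableZl measurableT 4 (iN n).
split; first exact: integrableD.
rewrite integralD // integralZl // integralZl // integral_sum //.
have -> : 5 * V = tau^-1 * (\sum_(m <= i < n) al i * V) + 4 * V.
  by rewrite -mulr_suml -/tau mulrA mulVf ?gt_eqF //; ring.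
rewrite (EFinD (tau^-1 * _)); apply: leeD; last first.
  by rewrite (EFinM 4) lee_pmul2l ?lte_fin // (noise_variance m n).2.
rewrite (EFinM tau^-1) lee_pmul2l ?lte_fin ?invr_gt0 // -sumEFin big_nat [leRHS]big_nat.
apply: lee_sum => i /andP[mi ni]; rewrite integralZl // (EFinM (al i)) lee_pmul2l ?lte_fin //.
apply: le_trans (noise_variance m i).2 _; rewrite lee_fin /V.
rewrite [leRHS](big_cat_nat mi (ltnW ni)) /= lerDl.
by apply: sumr_ge0 => j _; rewrite mulr_ge0 ?sqr_ge0.
Qed.

End VectorNoise.

(** * Numerical consequences of the definitions of the constants *)

Section StepSizeBounds.
Variables (R : realType) (L lam : R).
Hypotheses (L0 : 0 < L) (lam0 : 0 < lam).

Lemma xi_cE : xi_c L lam * (2 + 2 * L ^+ 2 * lam ^+ 2) = 1.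
Proof. by rewrite mulVf // gt_eqF // addr_gt0 // !mulr_gt0 // exprn_gt0. Qed.

Lemma xi_c_gt0 : 0 < xi_c L lam.
Proof. by rewrite invr_gt0 addr_gt0 // !mulr_gt0 // exprn_gt0. Qed.

Lemma lambar_c_ge : 6 <= lam * lambar_c L lam.
Proof.
have e3 : 3 <= expR (L * lam + 2).
  by apply: le_trans (expR_ge1Dx _); have := mulr_gt0 L0 lam0; lra.
have l2 : 2 <= lam * (L + 2 * lam^-1).
  rewrite mulrDr mulrCA divff ?gt_eqF // mulr1.
  by have := mulr_gt0 lam0 L0; lra.
rewrite /lambar_c mulrA; have -> : (6 : R) = 2 * 3 by ring.
by apply: ler_pM.
Qed.

(** With [lam * lambar >= 6] the condition bounding [5 * lambar ^+ 2 * t] gives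
    [180 * t <= 8 / 25 * (xi * lam)]. The 400 is chosen for windows of length at most [2 * T / 5]:
    then [1000 * tau <= 400 * T <= xi * lam]. *)
Lemma T_c_le : 0 < T_c L lam -> 400 * T_c L lam <= xi_c L lam * lam.
Proof.
rewrite /T_c; set S := [set t | _] => S0.
(* The supremum of the empty set is 0 by convention, which [S0] excludes. *)
have SS : S !=set0.
  by apply/set0P; apply: contraTneq S0 => ->; rewrite sup0 ltxx.
rewrite mulrC -ler_pdivlMr //; apply: ge_sup => // t [t0 _ _ h _].
rewrite ler_pdivlMr //.
move: h lambar_c_ge; set lb := lambar_c L lam; set xi := xi_c L lam => h lb6.
have h1 : 5 * lb ^+ 2 * t <= 8 * xi / (25 * lam).
  apply: le_trans h; rewrite lerDr.
  by rewrite mulr_ge0 ?sqr_ge0 // mulr_ge0 ?sqr_ge0 // ltW.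
have {}h1 : 5 * (lam * lb) ^+ 2 * t <= 8 / 25 * (xi * lam).
  have := ler_wpM2r (sqr_ge0 lam) h1.
  have -> : 8 * xi / (25 * lam) * lam ^+ 2 = 8 / 25 * (xi * lam) by field; rewrite gt_eqF.
  by have -> : 5 * lb ^+ 2 * t * lam ^+ 2 = 5 * (lam * lb) ^+ 2 * t by ring.
have h2 : 36 * t <= (lam * lb) ^+ 2 * t.
  rewrite ler_pM2r //; have -> : (36 : R) = 6 ^+ 2 by ring.
  by rewrite ler_sqr ?nnegrE // (le_trans _ lb6).
lra.
Qed.

End StepSizeBounds.


Theorem theorem2p15
  (R : realType) (d : nat)
  (dT : measure_display) (Omega : measurableType dT) (P : probability Omega R)
  (F : nat -> set (set Omega))
  (phi : 'rV[R]_d -> \bar R) (f : 'rV[R]_d -> R)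
  (lam L psibar : R) (alpha sigma : nat -> R) (z0 : 'rV[R]_d)
  (z x g : nat -> Omega -> 'rV[R]_d) :
  (* standing assumptions *)
  filtration F ->
  convex_fun phi -> lsc_fun phi -> proper_fun phi ->
  C1 f ->
  0 < lam ->
  (forall k, 0 < alpha k) ->
  (* the method *)
  (forall w, z 0%N w = z0) ->
  (forall k w, x k w = prox lam phi (z k w)) ->
  (forall k, rvec_measurable_wrt (F k.+1) (g k)) ->
  (forall k w, z k.+1 w =
     z k w - alpha k *: (g k w + grad_env lam phi (z k w))) ->
  (* (A.1) *)
  (forall y, domf phi y -> (psibar%:E <= (f y)%:E + phi y)%E) ->
  (* (A.2) *)
  (forall k, cond_exp_is P (F k) (g k) (fun w => grad f (x k w))) ->
  (forall k, 0 <= sigma k) ->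
  (forall k, (\int[P]_w (sqnorm (g k w - grad f (x k w)))%:E
                <= (sigma k ^+ 2)%:E)%E) ->
  (* (A.3) *)
  ((fun n => \sum_(i < n) alpha i) @ \oo --> +oo) ->
  (alpha @ \oo --> 0) ->
  (* (B.1) *)
  0 < L -> lipschitz_vf (grad f) L ->
  (* step sizes *)
  (forall k, alpha k <= T_c L lam / 5) ->
  forall k : nat, (1 <= k)%N ->
    (\big[Order.min/+oo]_(i < k)
        \int[P]_w (sqnorm (Fnat f lam phi (x i w)))%:E
     <= (D1_c L lam)%:E * (Hxi f phi lam (xi_c L lam) z0 - psibar%:E)
          * ((\sum_(i < k) alpha i)^-1)%:E
        + ((D2_c L lam) * (\sum_(i < k) alpha i ^+ 2 * sigma i ^+ 2)
           / (\sum_(i < k) alpha i))%:E)%E.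
Proof.
move=> filF cphi lphi pphi C1f lam0 al0 z0E xE Fg zS psi_ge ce sg0 e2 _ _ L0 fL alT k k1.
have T0 : 0 < T_c L lam by have := al0 0%N; have := alT 0%N; lra.
have T400 := T_c_le L0 lam0 T0; have xi0 := xi_c_gt0 L0 lam0.
have xiE := xi_cE L0 lam0; have lb6 := lambar_c_ge L0 lam0.
have [s [s1 s2 s3]] := window_partition T0 al0 alT (leq0n k).
set xi := xi_c L lam in T400 xi0 xiE *; set T := T_c L lam in T0 T400 alT s3.
pose G := Fnor f lam phi.
pose e j w := g j w - grad f (x j w).
have zS' w j : z j.+1 w = z j w - alpha j *: (G (z j w) + e j w).
  rewrite zS /G /Fnor /e xE /grad_env; congr (_ - _ *: _).
  move: (grad f _) (_ *: _) (g j w) => a b c.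
  by rewrite (addrC a) addrACA subrr addr0 addrC.
have Fe j : rvec_measurable_wrt (F j.+1) (e j).
  move=> i; have [sF _ Fj] := filF j; have [sF' _ _] := filF j.+1.
  have [_ _ mY _] := ce j i.
  apply/(measurable_wrtE _ sF').
  have -> : (fun w => e j w ord0 i) = (fun w => g j w ord0 i - grad f (x j w) ord0 i).
    by apply/funext => w; rewrite /e [in LHS]mxE [X in _ + X]mxE.
  apply: measurable_funB; first by apply/(measurable_wrtE _ sF'); exact: Fg.
  by apply/(measurable_wrtE _ sF') => B mB; apply: Fj; exact: mY.
have e0 j i A : F j A -> (\int[P]_(w in A) (e j w ord0 i)%:E = 0)%E.
  move=> FA; have [_ FM _] := filF j; have [ig iY _ gY] := ce j i.
  have mA := FM _ FA.
  have -> : (fun w => (e j w ord0 i)%:E) =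
      (fun w => (g j w ord0 i)%:E - (grad f (x j w) ord0 i)%:E)%E.
    by apply/funext => w; rewrite /e -EFinB [in LHS]mxE [X in _ + X]mxE.
  have igA := integrableS measurableT mA (@subsetT _ A) ig.
  have iYA := integrableS measurableT mA (@subsetT _ A) iY.
  by rewrite integralB // gY // subee // integrable_fin_num.
have WE := window_noise_expectation filF al0 Fe e0 e2.
pose H w i := merit phi f lam xi (z i w) - psibar.
pose W w i j := window_noise alpha (e^~ w) i j.
have W0 w i j : 0 <= W w i j.
  rewrite addr_ge0 ?mulr_ge0 ?invr_ge0 ?sqnorm_ge0 //.
    by apply: sumr_ge0 => l _; exact: ltW.
  by apply: sumr_ge0 => l _; rewrite mulr_ge0 ?sqnorm_ge0 // ltW.
(* This lower bound pays for the last, possibly short, window of the partition. *)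
have Hge w i : xi / 10 * (T * sqnorm (G (z i w))) <= H w i.
  have := merit_ge cphi lphi pphi C1f lam0 L0 fL psi_ge xi (z i w); rewrite -/G /H => h.
  have : xi * T * sqnorm (G (z i w)) <= xi * lam * sqnorm (G (z i w)).
    rewrite ler_wpM2r ?sqnorm_ge0 // ler_pM2l //.
    have : 0 <= xi * (L ^+ 2 * lam ^+ 2).
      by rewrite mulr_ge0 ?(ltW xi0) // mulr_ge0 ?sqr_ge0.
    move=> xiL; have : xi * lam <= lam by rewrite ler_piMl ?(ltW lam0) //; lra.
    lra.
  have : 0 <= xi * lam * sqnorm (G (z i w)) by rewrite mulr_ge0 ?sqnorm_ge0 // mulr_ge0 // ltW.
  lra.
have path w : xi / 10 * (\sum_(p <- s) (\sum_(p.1 <= l < p.2) alpha l) * sqnorm (G (z p.1 w)))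
    <= H w 0%N + 5 / T * \sum_(p <- s) W w p.1 p.2.
  have := s3 (H w) (fun i => sqnorm (G (z i w))) (W w) (xi / 10); apply=> //.
  - by rewrite divr_ge0 // ltW.
  - by move=> i; exact: sqnorm_ge0.
  move=> i j ij tau.
  have tl : 1000 * (\sum_(i <= l < j) alpha l) <= xi * lam by lra.
  have : merit phi f lam xi (z j w) <= merit phi f lam xi (z i w)
      - 1 / 10 * (xi * (\sum_(i <= l < j) alpha l) * sqnorm (G (z i w)))
      + (\sum_(i <= l < j) alpha l)^-1 * W w i j.
    exact: (window_descent cphi lphi pphi C1f lam0 L0 fL psi_ge xiE al0 (zS' w) ij tl).
  rewrite /H; move: (merit _ _ _ _ (z j w)) (merit _ _ _ _ (z i w)) => Hj Hi.
  move: (\sum_(i <= l < j) alpha l) (W w i j) (sqnorm _) => t Wij U.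
  move: (t^-1 * Wij) => q; lra.
pose I i := (\int[P]_w (sqnorm (Fnat f lam phi (x i w)))%:E)%E.
pose tau (p : nat * nat) := \sum_(p.1 <= l < p.2) alpha l.
have tau0 p : 0 <= tau p by apply: sumr_ge0 => l _; exact: ltW.
pose A := \sum_(i < k) alpha i; pose V := \sum_(i < k) alpha i ^+ 2 * sigma i ^+ 2.
have AE : A = \sum_(p <- s) tau p by rewrite (s1 alpha) big_mkord.
have VE : V = \sum_(p <- s) \sum_(p.1 <= j < p.2) alpha j ^+ 2 * sigma j ^+ 2.
  by rewrite (s1 (fun j => _)) big_mkord.
have A0 : 0 < A by rewrite /A (bigD1 (Ordinal k1)) //= ltr_pwDl // sumr_ge0 // => l _; exact: ltW.
have V0 : 0 <= V by apply: sumr_ge0 => i _; rewrite mulr_ge0 ?sqr_ge0.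
have fnat0 i w : 0 <= sqnorm (Fnat f lam phi (x i w)) by exact: sqnorm_ge0.
set mu := \big[Order.min/+oo%E]_(i < k) _.
(* Each window starts at an index below [k], so the minimum is at most the expectation there, and
   the window weights add up to [A]. *)
have muI : (A%:E * mu <= \sum_(p <- s) (tau p)%:E * I p.1)%E.
  rewrite AE -sumEFin ge0_sume_distrl => [|p _]; last by rewrite lee_fin.
  rewrite big_seq [leRHS]big_seq; apply: lee_sum => p /s2/andP[p12 pk].
  rewrite lee_wpmul2l ?lee_fin //.
  exact: (@bigmin_le _ _ _ _ (Ordinal (leq_trans p12 pk)) (fun i : 'I_k => I i)).
set Delta := merit phi f lam xi z0 - psibar.
have HE w : H w 0%N = Delta by rewrite /H z0E.
(* [10 / xi] inverts the descent coefficient [xi / 10], and [lam ^+ 2] converts [|G|^2] into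
   [|Fnat|^2]. *)
pose c := lam ^+ 2 * (10 / xi).
have c0 : 0 <= c by rewrite mulr_ge0 ?sqr_ge0 // divr_ge0 // ltW.
have bound w : \sum_(p <- s) tau p * sqnorm (Fnat f lam phi (x p.1 w)) <=
    c * Delta + c * (5 / T) * \sum_(p <- s) W w p.1 p.2.
  have h1 : \sum_(p <- s) tau p * sqnorm (Fnat f lam phi (x p.1 w)) <=
      lam ^+ 2 * \sum_(p <- s) tau p * sqnorm (G (z p.1 w)).
    rewrite mulr_sumr; apply: ler_sum => p _; rewrite mulrCA ler_wpM2l // xE.
    exact: (FnatE_le cphi lphi pphi C1f lam0 L0 fL psi_ge).
  apply: le_trans h1 _; have := ler_wpM2l c0 (path w); rewrite HE.
  have -> : c * (xi / 10 * \sum_(p <- s) tau p * sqnorm (G (z p.1 w))) =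
    lam ^+ 2 * \sum_(p <- s) tau p * sqnorm (G (z p.1 w)).
    by rewrite /c; field; rewrite gt_eqF.
  by rewrite mulrDr mulrA.
have iW p := (WE p.1 p.2).1.
have iSW : P.-integrable setT (fun w => \sum_(p <- s) (W w p.1 p.2)%:E)%E.
  by apply: integrable_sum => // p _; exact: iW.
have icW := integrableZl measurableT (c * (5 / T)) iSW.
have iC : P.-integrable setT (cst (c * Delta)%:E : Omega -> \bar R).
  exact: finite_measure_integrable_cst.
have sumI : (\sum_(p <- s) (tau p)%:E * I p.1 <= (c * Delta + c * (5 / T) * (5 * V))%:E)%E.
  (* Superadditivity puts the weighted sum under one integral, where the pathwise bound applies; its
     right-hand side is integrable, so ordinary linearity takes over. *)
  apply: le_trans (lower_integral_sum_le P s tau0 _) _ => [p w|]; first by rewrite lee_fin.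
  apply: le_trans (_ : _ <= \int[P]_w ((c * Delta)%:E +
      (c * (5 / T))%:E * \sum_(p <- s) (W w p.1 p.2)%:E))%E _.
    apply: le_lower_integral => w.
      by apply: sume_ge0 => p _; rewrite mule_ge0 // lee_fin.
    under eq_bigr do rewrite -EFinM.
    by rewrite !sumEFin -EFinM -EFinD lee_fin.
  rewrite integralD // integralZl // integral_cst //.
  rewrite [X in (_ * X + _)%E](_ : _ = 1%E) ?mule1; last exact: probability_setT.
  rewrite (EFinD (c * Delta)) leeD2l // (EFinM (c * (5 / T))) lee_wpmul2l //.
    by rewrite lee_fin mulr_ge0 // divr_ge0 // ltW.
  rewrite integral_sum // VE mulr_sumr -sumEFin; apply: lee_sum => p _.
  exact: (WE p.1 p.2).2.
have Delta0 : 0 <= Delta.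
  have := merit_ge cphi lphi pphi C1f lam0 L0 fL psi_ge xi z0; rewrite -/G /Delta => h.
  rewrite subr_ge0 (le_trans _ h) // lerDl mulr_ge0 ?sqnorm_ge0 // divr_ge0 //.
  by rewrite mulr_ge0 // ltW.
have lb1 : 49 <= (1 + lam * lambar_c L lam) ^+ 2.
  have -> : (49 : R) = 7 ^+ 2 by ring.
  by rewrite ler_sqr ?nnegrE; lra.
have l2 : 0 < lam ^+ 2 by rewrite exprn_gt0.
have xi'0 : 0 < xi^-1 by rewrite invr_gt0.
have D1 : c <= D1_c L lam.
  rewrite /c /D1_c -/xi.
  have -> : lam ^+ 2 * (10 / xi) = 1 * (10 * lam ^+ 2 / xi) by ring.
  have -> : 10 * (1 + lam * lambar_c L lam) ^+ 2 * lam ^+ 2 / xi =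
    (1 + lam * lambar_c L lam) ^+ 2 * (10 * lam ^+ 2 / xi) by ring.
  by apply: ler_wpM2r; [rewrite !mulr_ge0 // ltW|lra].
(* The left side is [250 * lam ^+ 2 / (T * xi)], below the first entry of the maximum because
   [(1 + lam * lambar) ^+ 2 >= 49]. *)
have D2 : c * (5 / T) * 5 <= D2_c L lam.
  rewrite /D2_c le_max -/T -/xi; apply/orP; left.
  have -> : c * (5 / T) * 5 = 250 * (lam ^+ 2 / (T * xi)).
    by rewrite /c; field; rewrite !gt_eqF.
  have -> : 200 * (1 + lam * lambar_c L lam) ^+ 2 * lam ^+ 2 / (T * xi) =
    (200 * (1 + lam * lambar_c L lam) ^+ 2) * (lam ^+ 2 / (T * xi)) by ring.
  by apply: ler_wpM2r; [rewrite divr_ge0 // ltW // mulr_gt0|lra].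
rewrite (HxiE cphi lphi pphi C1f lam0 L0 fL psi_ge) -/xi -/A -/V -EFinB -/Delta.
rewrite -!EFinM -EFinD.
have -> : D1_c L lam * Delta * A^-1 + D2_c L lam * V / A =
  A^-1 * (D1_c L lam * Delta + D2_c L lam * V) by ring.
rewrite EFinM lee_pdivlMl //; apply: le_trans muI _; apply: le_trans sumI _.
rewrite lee_fin lerD ?ler_wpM2r //.
by rewrite mulrA ler_wpM2r.
Qed.
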